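(* Let $d=2$ and $\delta>0$. Then the nonlocal FEM stiffness matrix $\boldsymbol S_\delta$ is an $N_2$-by-$N_2$ symmetric block-Toeplitz matrix $$\boldsymbol S_\delta=\begin{bmatrix}\boldsymbol T_0&\boldsymbol T_1&\cdots&\boldsymbol T_{N_2-1}\\ \boldsymbol T_1&\boldsymbol T_0&\ddots&\vdots\\ \vdots&\ddots&\ddots&\boldsymbol T_1\\ \boldsymbol T_{N_2-1}&\cdots&\boldsymbol T_1&\boldsymbol T_0\end{bmatrix},$$ i.e. its $(p,q)$ block is $\boldsymbol T_{|p-q|}$ for $1\le p,q\le N_2$, where for each $0\le k_2\le N_2-1$ the block $\boldsymbol T_{k_2}$ is the $N_1$-by-$N_1$ symmetric Toeplitz matrix with $(i,j)$ entry $t^{k_2}_{|i-j|}$, $1\le i,j\le N_1$, and $$t_{k_1}^{k_2}=h^2\int_0^{\pi}\Big(\int_0^{\delta} r\,\rho_\delta(r)\,\hat f_{k_1,k_2}(r,\theta)\,\mathrm{d}r\Big)\mathrm{d}\theta,\qquad 0\le k_1\le N_1-1,$$ where $$\begin{aligned}\hat f_{k_1,k_2}(r,\theta)=\;&2B_3(k_1+2)B_3(k_2+2)-B_3(k_1+2+r\cos\theta/h)\,B_3(k_2+2+r\sin\theta/h)\\&-B_3(k_1+2-r\cos\theta/h)\,B_3(k_2+2-r\sin\theta/h).\end{aligned}$$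
   Context: Domain and grid: $\Omega=(a_1,b_1)\times(a_2,b_2)$ and $\widetilde\Omega=(a_1-\delta,b_1+\delta)\times(a_2-\delta,b_2+\delta)$. For $j=1,2$, $N_j\ge1$ is an integer and $h=(b_j-a_j)/(N_j+1)$ is the same for $j=1,2$. Grid points are $\xi_{j,n_j}=a_j+n_jh$, $0\le n_j\le N_j+1$. Basis: for $1\le n_j\le N_j$, $\phi_{n_j}(x_j)$ is the hat function equal to $(x_j-\xi_{j,n_j-1})/h$ on $(\xi_{j,n_j-1},\xi_{j,n_j})$, equal to $(\xi_{j,n_j+1}-x_j)/h$ on $(\xi_{j,n_j},\xi_{j,n_j+1})$ (value $1$ at $\xi_{j,n_j}$), and zero elsewhere (extended by zero to all of $\mathbb{R}$). The 2D basis functions are $\phi_{n_1}(x_1)\phi_{n_2}(x_2)$. Kernel: $\mathbb{B}^2_\delta$ is the disc of radius $\delta$ centered at $0$; $\rho_\delta(|\boldsymbol s|)$ is a radial kernel, non-increasing in $|\boldsymbol s|$, with $\int_{\mathbb{B}^2_\delta}\rho_\delta(|\boldsymbol s|)|\boldsymbol s|^2\,\mathrm{d}\boldsymbol s=2$. Bilinear form: $$\mathcal{A}_\delta(u,v)=\frac12\int_{\widetilde\Omega}\int_{\mathbb{B}^2_\delta}(u(\boldsymbol x+\boldsymbol s)-u(\boldsymbol x))(v(\boldsymbol x+\boldsymbol s)-v(\boldsymbol x))\rho_\delta(|\boldsymbol s|)\,\mathrm{d}\boldsymbol s\,\mathrm{d}\boldsymbol x.$$ The stiffness matrix $\boldsymbol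 S_\delta\in\mathbb{R}^{N_1N_2\times N_1N_2}$ has entries $(\boldsymbol S_\delta)_{ll'}=\mathcal{A}_\delta(\phi_{n_1}\phi_{n_2},\phi_{m_1}\phi_{m_2})$ with $l=(n_2-1)N_1+n_1$, $l'=(m_2-1)N_1+m_1$. Cubic B-spline: $B_3(t)=t^3/6$ on $[0,1)$; $-t^3/2+2t^2-2t+2/3$ on $[1,2)$; $t^3/2-4t^2+10t-22/3$ on $[2,3)$; $-(t-4)^3/6$ on $[3,4)$; $0$ elsewhere. *)

(* Defs.v *)
From HB Require Import structures.
From mathcomp Require Import all_boot all_order all_algebra.
From mathcomp Require Import all_classical all_reals all_analysis.
Import Order.TTheory GRing.Theory Num.Theory.

Set Implicit Arguments.
Unset Strict Implicit.
Unset Printing Implicit Defensive.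

Local Open Scope classical_set_scope.
Local Open Scope ring_scope.

Section Discretization.
Variable R : realType.

Definition grid_point (a h : R) (n : nat) : R := a + n%:R * h.

(* Meant for n >= 1; the value 1 at the node n comes from the first branch. *)
Definition hat (a h : R) (n : nat) (x : R) : R :=
  if grid_point a h n.-1 < x <= grid_point a h n then
    (x - grid_point a h n.-1) / h
  else if grid_point a h n < x < grid_point a h n.+1 then
    (grid_point a h n.+1 - x) / h
  else 0.

Definition basis (a1 a2 h : R) (n1 n2 : nat) (x : R * R) : R :=
  hat a1 h n1 x.1 * hat a2 h n2 x.2.

Definition lebesgue2 :
    {measure set (measurableTypeR R * measurableTypeR R) -> \bar R} :=
  (@lebesgue_measure R \x @lebesgue_measure R)%E.

(* The library norm on R * R is the max norm. *)
Definition eucl_norm (s : R * R) : R := Num.sqrt (s.1 ^+ 2 + s.2 ^+ 2).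

Definition disc (delta : R) : set (R * R) := [set s | eucl_norm s < delta].

Definition extended_domain (a1 b1 a2 b2 delta : R) : set (R * R) :=
  `]a1 - delta, b1 + delta[ `*` `]a2 - delta, b2 + delta[.

Definition bilinear_form (a1 b1 a2 b2 delta : R) (rho : R -> R)
    (u v : R * R -> R) : R :=
  2^-1 * \int[lebesgue2]_(x in extended_domain a1 b1 a2 b2 delta)
           \int[lebesgue2]_(s in disc delta)
             ((u (x + s) - u x) * (v (x + s) - v x) * rho (eucl_norm s)).

(* Matrix indices start at 0: l stands for the 1-based index
   l + 1 = (n2 - 1) * N1 + n1, so n1 = l %% N1 + 1 and n2 = l %/ N1 + 1. *)
Definition stiffness_matrix (a1 b1 a2 b2 delta h : R) (rho : R -> R)
    (N1 N2 : nat) : 'M[R]_(N1 * N2) :=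
  \matrix_(l, l')
    bilinear_form a1 b1 a2 b2 delta rho
      (basis a1 a2 h (l %% N1).+1 (l %/ N1).+1)
      (basis a1 a2 h (l' %% N1).+1 (l' %/ N1).+1).

Definition B3 (t : R) : R :=
  if 0 <= t < 1 then t ^+ 3 / 6
  else if 1 <= t < 2 then - t ^+ 3 / 2 + 2 * t ^+ 2 - 2 * t + 2 / 3
  else if 2 <= t < 3 then t ^+ 3 / 2 - 4 * t ^+ 2 + 10 * t - 22 / 3
  else if 3 <= t < 4 then - (t - 4) ^+ 3 / 6
  else 0.

Definition fhat (h : R) (k1 k2 : nat) (r theta : R) : R :=
  2 * B3 (k1%:R + 2) * B3 (k2%:R + 2)
  - B3 (k1%:R + 2 + r * cos theta / h) * B3 (k2%:R + 2 + r * sin theta / h)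
  - B3 (k1%:R + 2 - r * cos theta / h) * B3 (k2%:R + 2 - r * sin theta / h).

Definition toeplitz_coef (delta h : R) (rho : R -> R) (k1 k2 : nat) : R :=
  h ^+ 2 * \int[lebesgue_measure]_(theta in `[0, pi])
             \int[lebesgue_measure]_(r in `]0, delta[)
               (r * rho r * fhat h k1 k2 r theta).

End Discretization.

Definition sym_toeplitz (R : Type) (n : nat) (t : nat -> R) : 'M[R]_n :=
  \matrix_(i, j) t `|i - j|%N.

Lemma block_size (N1 N2 : nat) : (\sum_(p < N2) N1 = N1 * N2)%N.
Proof. by rewrite sum_nat_const card_ord mulnC. Qed.

(* The cast only identifies the size \sum_(p < N2) N1 of the library's block
   matrix with N1 * N2. *)
Definition sym_block_toeplitz (R : Type) (N1 N2 : nat) (T : nat -> 'M[R]_N1) :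
    'M[R]_(N1 * N2) :=
  castmx (block_size N1 N2, block_size N1 N2)
    (\mxblock_(p < N2, q < N2) T `|p - q|%N).

(* Main.v *)
From HB Require Import structures.
Require Import Defs.
From mathcomp Require Import all_boot all_order all_algebra.
From mathcomp Require Import all_classical all_reals all_analysis.
From mathcomp Require Import measurable_realfun.
From mathcomp Require Import ring lra.
Import Order.TTheory GRing.Theory Num.Theory.
Import numFieldNormedType.Exports.

Set Implicit Arguments.
Unset Strict Implicit.
Unset Printing Implicit Defensive.

Local Open Scope classical_set_scope.
Local Open Scope ring_scope.

(** Why the stiffness matrix is block Toeplitz with the stated entries.

    Let u and v be two basis functions.  Both vanish outside Omega, so for
    |s| < delta the integrand of the bilinear form vanishes when x is outside
    the extended domain, and the outer integral may be taken over the whole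
    plane.  The integrand is dominated by a constant times |s|^2 rho(|s|) on a
    bounded set of x, because the basis functions are Lipschitz; the
    normalization of rho makes this bound integrable.  Hence Fubini applies
    and the integral over x can be done first.  Expanding

      (u(x+s) - u(x)) (v(x+s) - v(x))

    gives four correlations of tensor products of hat functions.  In one
    dimension the correlation of two hat functions is h times the cubic
    B-spline at 2 + (distance of their nodes) / h, since B3 is the convolution
    of two hats (integral_tent_tent, integral_hat_hat).  The integral over x is
    therefore h^2 times a second difference of the product spline
    (Rintegral_increment_product); it depends on the indices of the nodes only
    through their differences, which is the Toeplitz structure, and a
    reflection of the first coordinate of s, together with the symmetry of B3
    about 2, removes the signs of these differences.

    What is left is an integral over the disc of rho(|s|) times a function that
    is even in s.  Polar coordinates turn it into twice the integral over the
    half circle 0 <= theta <= pi (Rintegral_polar), and the factor two cancels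
    the one half of the bilinear form.

    Polar coordinates are obtained by one-dimensional substitutions and
    Tonelli: with x = y c for fixed y, then y = r cos(atan c) for fixed c, then
    c = tan t, the plane is swept by the lines through the origin.  The
    substitution by the tangent holds for all measurable functions because the
    measure of density 1 / cos^2 is mapped by tan to the Lebesgue measure. *)

(** * One-dimensional changes of variables *)

Section density.
Local Open Scope ereal_scope.
Import HBNNSimple.

Lemma density_measure d (T : measurableType d) (R : realType)
    (mu : {measure set T -> \bar R}) (g : T -> R) :
  measurable_fun setT g -> (forall x, 0 <= g x)%R ->
  exists nu : {measure set T -> \bar R},
    forall A, nu A = \int[mu]_(x in A) (g x)%:E.
Proof.
move=> mg g0; pose nu A := \int[mu]_(x in A) (g x)%:E.
have nu0 : nu set0 = 0 by rewrite /nu integral_set0.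
have nu_ge0 A : 0 <= nu A by apply: integral_ge0 => x _; rewrite lee_fin.
have nu_sigma : semi_sigma_additive nu.
  apply: semi_sigma_additive_nng_induced; first exact/measurable_EFinP.
  by move=> x; rewrite lee_fin.
pose nuM := isMeasure.Build _ _ _ nu nu0 nu_ge0 nu_sigma.
pose nu' : {measure set T -> \bar R} := HB.pack nu nuM.
by exists nu'.
Qed.

(** By monotone convergence it suffices to treat simple functions, and by
    linearity indicators, for which the claim is the hypothesis on nu. *)
Lemma ge0_integral_density d (T : measurableType d) (R : realType)
    (mu nu : {measure set T -> \bar R}) (g : T -> R) (f : T -> \bar R) :
  measurable_fun setT g -> (forall x, 0 <= g x)%R ->
  (forall A, measurable A -> nu A = \int[mu]_(x in A) (g x)%:E) ->
  measurable_fun setT f -> (forall x, 0 <= f x) ->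
  \int[nu]_x f x = \int[mu]_x (f x * (g x)%:E).
Proof.
move=> mg g0 nuE mf f0.
have meg : measurable_fun setT (EFin \o g) by exact/measurable_EFinP.
pose h := nnsfun_approx measurableT mf.
have hf x : EFin \o h ^~ x @ \oo --> f x by exact: cvg_nnsfun_approx.
have hnd x m n : (m <= n)%N -> (h m x <= h n x)%R.
  by move=> mn; exact/lefP/nd_nnsfun_approx.
transitivity (limn (fun n => \int[nu]_x (h n x)%:E)).
  rewrite -monotone_convergence//.
  - by apply: eq_integral => x _; apply/esym/cvg_lim => //; exact: hf.
  - by move=> n; exact/measurable_EFinP.
  - by move=> n x _; rewrite lee_fin.
  - by move=> x _ m n mn; rewrite lee_fin; exact: hnd.
transitivity (limn (fun n => \int[mu]_x ((h n x)%:E * (g x)%:E))); last first.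
  rewrite -monotone_convergence//.
  - apply: eq_integral => x _; apply/cvg_lim => //.
    by apply: cvgeZr => //; exact: hf.
  - move=> n; apply: emeasurable_funM => //; exact/measurable_EFinP.
  - by move=> n x _; rewrite mule_ge0// lee_fin.
  - move=> x _ m n mn; rewrite lee_wpmul2r ?lee_fin//; exact: hnd.
congr (limn _); apply/funext => n.
have mh r : measurable (h n @^-1` [set r]) by [].
under eq_integral do rewrite fimfunE -fsumEFin//.
rewrite ge0_integral_fsum//; last 2 first.
- by move=> r; exact/measurable_EFinP/measurable_funM.
- by move=> r x _; rewrite nnfun_muleindic_ge0.
under [RHS]eq_integral.
  move=> x _; rewrite fimfunE -fsumEFin// ge0_mule_fsuml//; last first.
    by move=> r; exact: nnfun_muleindic_ge0.
  over.
rewrite ge0_integral_fsum//; last 2 first.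
- move=> r; apply: emeasurable_funM => //.
  exact/measurable_EFinP/measurable_funM.
- by move=> r x _; rewrite mule_ge0 ?nnfun_muleindic_ge0 ?lee_fin.
apply: eq_fsbigr => r rhn.
rewrite integralZl_indic_nnsfun// integral_indic//= setIT nuE//.
under [RHS]eq_integral do rewrite EFinM -muleA.
rewrite ge0_integralZl//; last 3 first.
- by apply: emeasurable_funM => //; exact/measurable_EFinP.
- by move=> x _; rewrite mule_ge0 ?lee_fin.
- by move: rhn; rewrite inE => -[x _ <-]; rewrite lee_fin.
congr (_ * _); rewrite integral_mkcond; apply: eq_integral => x _.
by rewrite epatch_indic/= muleC.
Qed.

End density.

Section change_of_variables.
Context {R : realType}.
Local Open Scope ereal_scope.
Notation mu := (@lebesgue_measure R).

Lemma ge0_integral_opp (f : R -> \bar R) :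
  measurable_fun setT f -> (forall x, 0 <= f x) ->
  \int[mu]_x f x = \int[mu]_x f (- x)%R.
Proof.
move=> mf f0.
pose phi : R -> measurableTypeR R := -%R.
have mphi : measurable_fun setT phi by exact: oppr_measurable.
transitivity (\int[pushforward mu phi]_x f x).
  by apply: eq_measure_integral => A mA _; exact/esym/lebesgue_measureN.
by rewrite ge0_integral_pushforward// preimage_setT.
Qed.

(** The scaled Lebesgue measure is pushed by x |-> a x + b to the Lebesgue
    measure, as one sees on half-open intervals; uniqueness of the latter
    then extends this to all measurable sets. *)
Let ge0_integral_affine_pos (a b : R) (f : R -> \bar R) : (0 < a)%R ->
  measurable_fun setT f -> (forall x, 0 <= f x) ->
  \int[mu]_x f x = \int[mu]_x (a%:E * f (a * x + b)%R).
Proof.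
move=> a0 mf f0.
pose phi : R -> measurableTypeR R := fun x => (a * x + b)%R.
have mphi : measurable_fun setT phi.
  by apply: measurable_funD => //; exact: measurable_funM.
pose k := NngNum (ltW a0).
have muE A : measurable A -> pushforward (mscale k mu) phi A = mu A.
  move=> mA; apply/esym/lebesgue_measure_unique => //= _ [[u v] _ <-].
  rewrite /= /pushforward /mscale/=.
  rewrite [phi @^-1` _](_ : _ =
      `]((u - b) / a)%R, ((v - b) / a)%R]%classic); last first.
    apply/seteqP; split => x /=; rewrite !in_itv/= /phi;
    by rewrite ltr_pdivrMr// ler_pdivlMr// ltrBlDr lerBrDr mulrC.
  rewrite !lebesgue_measure_itv/= !lte_fin ltr_pM2r ?invr_gt0// ltrD2r.
  case: ifPn => _; last by rewrite mule0.
  by rewrite -!EFinD -EFinM; congr EFin; field; rewrite gt_eqF.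
transitivity (\int[pushforward (mscale k mu) phi]_x f x).
  by apply: eq_measure_integral => A mA _; exact/esym/muE.
rewrite ge0_integral_pushforward// preimage_setT ge0_integral_mscale//=.
  by rewrite ge0_integralZl//= ?lee_fin ?ltW//; exact: measurableT_comp.
exact: measurableT_comp.
Qed.

Lemma ge0_integral_affine (a b : R) (f : R -> \bar R) : a != 0%R ->
  measurable_fun setT f -> (forall x, 0 <= f x) ->
  \int[mu]_x f x = \int[mu]_x (`|a|%:E * f (a * x + b)%R).
Proof.
move=> a0 mf f0; have [a_lt0|a_gt0] := ltP a 0%R.
  rewrite (ge0_integral_affine_pos (a := - a) b)// ?oppr_gt0//.
  rewrite ge0_integral_opp//.
  - by apply: eq_integral => x _; rewrite ltr0_norm// mulrNN.
  - apply: emeasurable_funM => //; apply: measurableT_comp => //.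
    by apply: measurable_funD => //; exact: measurable_funM.
  - by move=> x; rewrite mule_ge0// lee_fin oppr_ge0 ltW.
rewrite gtr0_norm ?lt_neqAle 1?eq_sym ?a0//.
by apply: ge0_integral_affine_pos => //; rewrite lt_neqAle eq_sym a0.
Qed.

Lemma integral_derivative (F f : R -> R) (a b : R) : (a < b)%R ->
  {in `[a, b], forall t : R, is_derive t (1%R : R) F (f t)} ->
  {in `[a, b], continuous f} ->
  \int[mu]_(t in `[a, b]) (f t)%:E = (F b - F a)%:E.
Proof.
move=> ab dF cf.
have cF t : t \in `[a, b] -> {for t, continuous F}.
  move=> /dF[dFt _].
  by apply: differentiable_continuous; exact/derivable1_diffP.
rewrite (@continuous_FTC2 _ _ F)//.
- by apply: continuous_in_subspaceT => t /[!inE] tI; exact: cf.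
- split.
  + by move=> t /subset_itv_oo_cc /dF[].
  + by apply: cvg_at_right_filter; apply: cF; rewrite bound_itvE ltW.
  + by apply: cvg_at_left_filter; apply: cF; rewrite bound_itvE ltW.
- by move=> t /subset_itv_oo_cc /dF[_ <-]; rewrite derive1E.
Qed.

Lemma cos_gt0_atan_itv (a b t : R) : t \in `[atan a, atan b] -> (0 < cos t)%R.
Proof.
rewrite in_itv/= => /andP[at_ tb]; apply: cos_gt0_pihalf.
by rewrite (lt_le_trans (atan_gtNpi2 a))//= (le_lt_trans tb)// atan_ltpi2.
Qed.

Lemma continuous_cosVX2 (t : R) : (0 < cos t)%R ->
  {for t, continuous (fun x : R => (cos x)^-2)%R}.
Proof.
move=> cost; apply: continuousV; first by rewrite expf_neq0// gt_eqF.
exact: (continuousM (@continuous_cos R t) (@continuous_cos R t)).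
Qed.

Lemma integral_cosVX2 (a b : R) : (a < b)%R ->
  \int[mu]_(t in `[atan a, atan b]) ((cos t)^-2)%:E = (b - a)%:E.
Proof.
move=> ab; rewrite (@integral_derivative (@tan R)) ?lt_atan//.
- by rewrite !atanK.
- move=> t /cos_gt0_atan_itv cost; apply: is_derive_tan; rewrite gt_eqF//.
- by move=> t /cos_gt0_atan_itv; exact: continuous_cosVX2.
Qed.

(** The image under tan of the measure of density 1 / cos^2 on
    ]-pi/2, pi/2[ gives ]a, b] the mass tan (atan b) - tan (atan a) = b - a, so
    it is the Lebesgue measure. *)
Lemma ge0_integral_tan (f : R -> \bar R) :
  measurable_fun setT f -> (forall x, 0 <= f x) ->
  \int[mu]_x f x =
  \int[mu]_(t in `](- (pi / 2))%R, (pi / 2)%R[) (f (tan t) * ((cos t)^-2)%:E).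
Proof.
move=> mf f0; pose I : set R := `](- (pi / 2))%R, (pi / 2)%R[%classic; rewrite -/I.
have Icos t : I t -> (0 < cos t)%R.
  by rewrite /I/= in_itv/=; exact: cos_gt0_pihalf.
have mI : measurable I by exact: measurable_itv.
pose phi : R -> measurableTypeR R := (@tan R) \_ I.
pose g := (fun x : R => (cos x)^-2)%R \_ I.
have mphi : measurable_fun setT phi.
  apply/(measurable_restrictT _ mI).
  apply: open_continuous_measurable_fun; first exact: interval_open.
  by move=> t /[!inE] /Icos cost; apply: continuous_tan; rewrite gt_eqF.
have mgI : measurable_fun I (fun x : R => (cos x)^-2)%R.
  apply: open_continuous_measurable_fun; first exact: interval_open.
  by move=> t /[!inE] /Icos; exact: continuous_cosVX2.
have mg : measurable_fun setT g by exact/(measurable_restrictT _ mI).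
have g0 x : (0 <= g x)%R.
  by rewrite /g patchE; case: ifPn => // _; rewrite invr_ge0 sqr_ge0.
have [nu nuE] := density_measure mu mg g0.
have muE A : measurable A -> pushforward nu phi A = mu A.
  move=> mA; apply/esym/lebesgue_measure_unique => //= _ [[a b] _ <-].
  rewrite /= /pushforward nuE.
  have [ab|ba] := ltP a b; last first.
    by rewrite set_itv_ge ?preimage_set0 ?measure0 ?integral_set0// -leNgt.
  rewrite lebesgue_measure_itv/= lte_fin ab -EFinB -integral_cosVX2//.
  rewrite -integral_itv_obnd_cbnd; last first.
    apply/measurable_EFinP; apply: (measurable_funS mI _ mgI) => t /=.
    rewrite /I/= !in_itv/= => /andP[at_ tb].
    by rewrite (lt_trans (atan_gtNpi2 a))//= (le_lt_trans tb)// atan_ltpi2.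
  rewrite (_ : `]atan a, atan b]%classic = (phi @^-1` `]a, b]) `&` I); last first.
    have le_atanE : {mono (@atan R) : x y / (x <= y)%R} := le_mono (@lt_atan R).
    have tanE t : I t -> (a < phi t <= b)%R = (atan a < t <= atan b)%R.
      move=> It; rewrite /phi patchE mem_set//.
      by rewrite -[in RHS](tanK It) (leW_mono le_atanE) le_atanE.
    apply/seteqP; split=> t /=; rewrite !in_itv/=.
      move=> tab; suff It : I t by rewrite tanE.
      move: tab => /andP[at_ tb]; rewrite /I/= in_itv/=.
      by rewrite (lt_trans (atan_gtNpi2 a))//= (le_lt_trans tb)// atan_ltpi2.
    by move=> [+ It]; rewrite tanE.
  rewrite integral_mkcondr.
  apply: (@eq_integral _ (measurableTypeR R) R mu) => t _.
  by rewrite /g !patchE; case: (t \in I).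
transitivity (\int[pushforward nu phi]_x f x).
  by apply: eq_measure_integral => A mA _; exact/esym/muE.
rewrite ge0_integral_pushforward// preimage_setT.
rewrite (@ge0_integral_density _ (measurableTypeR R) _ mu nu g (f \o phi) mg g0
  (fun A _ => nuE A) (measurableT_comp mf mphi) (fun x => f0 (phi x))).
rewrite [RHS]integral_mkcond; apply: eq_integral => t _.
by rewrite /g/= !patchE; case: ifPn => tI; rewrite ?mule0// /phi patchE tI.
Qed.

End change_of_variables.

(** * Polar coordinates *)

Section polar_coordinates.
Context {R : realType}.
Local Open Scope ereal_scope.
Notation mu := (@lebesgue_measure R).
Implicit Type F : R * R -> \bar R.

Lemma ge0_integral_even (f : R -> \bar R) :
  measurable_fun setT f -> (forall x, 0 <= f x) -> (forall x, f (- x)%R = f x) ->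
  \int[mu]_x f x = 2%:E * \int[mu]_(x in `]0%R, +oo[) f x.
Proof.
move=> mf f0 fN.
have mp : measurable (`]0%R, +oo[ : set R) by exact: measurable_itv.
have mn : measurable (`]-oo, 0%R[ : set R) by exact: measurable_itv.
rewrite -(@integral_setD1 _ _ 0%R); last 2 first.
- by apply: measurableD.
- exact: measurable_funTS.
rewrite (_ : setT `\ 0%R = `]-oo, 0%R[ `|` `]0%R, +oo[); last first.
  apply/seteqP; split => x /=; rewrite !in_itv/= andbT.
    by move=> [_ /eqP]; rewrite neq_lt => /orP.
  by move=> x0; split => //; apply/eqP; rewrite neq_lt; exact/orP.
rewrite ge0_integral_setU//; last 2 first.
- exact: measurable_funTS.
- apply/disj_setPS => x /=; rewrite !in_itv/= andbT => -[xn xp].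
  by have := lt_trans xn xp; rewrite ltxx.
suff -> : \int[mu]_(x in `]-oo, 0%R[) f x = \int[mu]_(x in `]0%R, +oo[) f x.
  by rewrite mule_natl mule2n.
rewrite integral_mkcond ge0_integral_opp//; last 2 first.
- by apply/(measurable_restrictT _ mn); exact: measurable_funTS.
- by move=> x; rewrite patchE; case: ifPn.
rewrite [RHS]integral_mkcond; apply: eq_integral => x _.
rewrite !patchE fN; congr (if _ then _ else _).
by apply/idP/idP; rewrite !inE/= !in_itv/= andbT oppr_lt0.
Qed.

Lemma tonelli12 F : measurable_fun setT F -> (forall z, 0 <= F z) ->
  \int[lebesgue2 R]_z F z = \int[mu]_x \int[mu]_y F (x, y).
Proof.
move=> mF F0.
exact: (@fubini_tonelli1 _ _ (measurableTypeR R) (measurableTypeR R) R mu mu F).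
Qed.

Lemma tonelli21 F : measurable_fun setT F -> (forall z, 0 <= F z) ->
  \int[lebesgue2 R]_z F z = \int[mu]_y \int[mu]_x F (x, y).
Proof.
move=> mF F0.
exact: (@fubini_tonelli2 _ _ (measurableTypeR R) (measurableTypeR R) R mu mu F).
Qed.

Lemma measurable_tonelli1 F : measurable_fun setT F -> (forall z, 0 <= F z) ->
  measurable_fun setT (fun x => \int[mu]_y F (x, y)).
Proof.
move=> mF F0.
exact: (@measurable_fun_fubini_tonelli_F _ _ (measurableTypeR R) (measurableTypeR R) R mu F).
Qed.

Lemma measurable_tonelli2 F : measurable_fun setT F -> (forall z, 0 <= F z) ->
  measurable_fun setT (fun y => \int[mu]_x F (x, y)).
Proof.
move=> mF F0.
exact: (@measurable_fun_fubini_tonelli_G _ _ (measurableTypeR R) (measurableTypeR R) R mu F).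
Qed.

(** For fixed y != 0 this is the substitution x = y c; the line y = 0 is
    negligible. *)
Lemma ge0_integral_slope F :
  measurable_fun setT F -> (forall z, 0 <= F z) ->
  \int[lebesgue2 R]_z F z =
  \int[mu]_c \int[mu]_y (`|y|%:E * F (y * c, y)%R).
Proof.
move=> mF F0.
pose H (z : R * R) := `|z.2|%:E * F (z.2 * z.1, z.2)%R.
have H0 z : 0 <= H z by rewrite mule_ge0.
have mH : measurable_fun setT H.
  apply: emeasurable_funM.
    by apply/measurable_EFinP; apply: measurableT_comp.
  apply: measurableT_comp => //; apply: measurable_fun_pair => //.
  exact: measurable_funM.
rewrite -(tonelli12 mH H0) (tonelli21 mH H0) (tonelli21 mF F0).
have mT0 : measurable ([set: R] `\ 0%R) by exact: measurableD.
have mint G : measurable_fun setT G -> (forall z, 0 <= G z) ->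
    measurable_fun ([set: R] `\ 0%R) (fun y => \int[mu]_x G (x, y)).
  by move=> mG G0; apply: measurable_funTS; exact: measurable_tonelli2.
rewrite -(integral_setD1 mT0 (mint F mF F0)) -[RHS](integral_setD1 mT0 (mint H mH H0)).
apply: eq_integral => y; rewrite inE => -[_ /= /eqP y0].
rewrite (ge0_integral_affine 0 y0)//; last first.
  by apply: measurableT_comp => //; exact: measurable_fun_pair.
by apply: eq_integral => x _; rewrite /H/= addr0.
Qed.

(** A line through the origin of slope c = tan t with respect to the vertical
    axis is parametrized by a signed radius r, with y = r cos t.  The weight
    |y| and the differential of y contribute a factor cos t each, which cancel
    the density 1 / cos^2 t of the angle. *)
Lemma ge0_integral_angle F :
  measurable_fun setT F -> (forall z, 0 <= F z) ->
  \int[lebesgue2 R]_z F z =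
  \int[mu]_(t in `](- (pi / 2))%R, (pi / 2)%R[)
    \int[mu]_r (`|r|%:E * F (r * sin t, r * cos t)%R).
Proof.
move=> mF F0; rewrite (ge0_integral_slope mF F0).
pose H (z : R * R) := `|z.2|%:E * F (z.2 * sin z.1, z.2 * cos z.1)%R.
have H0 z : 0 <= H z by rewrite mule_ge0.
have mH : measurable_fun setT H.
  apply: emeasurable_funM.
    by apply/measurable_EFinP; apply: measurableT_comp.
  apply: measurableT_comp => //; apply: measurable_fun_pair;
    apply: measurable_funM => //; apply: measurableT_comp => //;
    apply: continuous_measurable_fun; [exact: continuous_sin|exact: continuous_cos].
pose M t := \int[mu]_r H (t, r).
have mM : measurable_fun setT M by exact: measurable_tonelli1.
have M0 t : 0 <= M t by exact: integral_ge0.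
have mcos : measurable_fun setT (fun c : R => cos (atan c)).
  apply: continuous_measurable_fun => c.
  by apply: continuous_comp; [exact: continuous_atan|exact: continuous_cos].
have -> : \int[mu]_c \int[mu]_y (`|y|%:E * F (y * c, y)%R) =
    \int[mu]_c (M (atan c) * ((cos (atan c)) ^+ 2)%:E).
  apply: eq_integral => c _; set k := cos (atan c).
  have k0 : (0 < k)%R by rewrite cos_gt0_pihalf// atan_gtNpi2 atan_ltpi2.
  (* k is the cosine of the angle whose tangent is c, so y = k r gives y c = r sin. *)
  have kc : (k * c = sin (atan c))%R.
    by rewrite -[c in LHS]atanK /tan -/k mulrC divfK// gt_eqF.
  rewrite -ge0_integralZr//; last 2 first.
  - exact: measurableT_comp.
  - by rewrite lee_fin sqr_ge0.
  rewrite (@ge0_integral_affine _ k 0)//; first last.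
  - by move=> y; rewrite mule_ge0.
  - apply: emeasurable_funM.
      by apply/measurable_EFinP; exact: normr_measurable.
    apply: measurableT_comp => //; apply: measurable_fun_pair => //.
    exact: measurable_funM.
  - by rewrite gt_eqF.
  apply: eq_integral => r _; rewrite addr0 /H/= gtr0_norm// normrM gtr0_norm//.
  rewrite mulrAC kc [(sin _ * r)%R]mulrC [(k * r)%R]mulrC !muleA -!EFinM.
  by rewrite muleAC -EFinM; congr (_%:E * _); ring.
rewrite ge0_integral_tan; last 2 first.
- apply: emeasurable_funM.
    by apply: measurableT_comp => //; apply: continuous_measurable_fun => c;
      exact: continuous_atan.
  apply/measurable_EFinP; exact: measurable_funX.
- by move=> c; rewrite mule_ge0// lee_fin sqr_ge0.
apply: eq_integral => t; rewrite inE/= => tI; rewrite tanK//.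
rewrite -muleA -EFinM mulfV ?mule1// expf_neq0// gt_eqF//.
by apply: cos_gt0_pihalf; move: tI; rewrite in_itv.
Qed.

(** Evenness lets the signed radius be restricted to r > 0 at the price of a
    factor two, and t = pi / 2 - theta brings the angle to [0, pi]. *)
Lemma ge0_integral_polar F :
  measurable_fun setT F -> (forall z, 0 <= F z) ->
  (forall x y, F (- x, - y)%R = F (x, y)) ->
  \int[lebesgue2 R]_z F z =
  2%:E * \int[lebesgue2 R]_(p in `[0%R, pi] `*` `]0%R, +oo[)
    (p.2%:E * F (p.2 * cos p.1, p.2 * sin p.1)%R).
Proof.
move=> mF F0 FN.
pose G (p : R * R) := p.2%:E * F (p.2 * cos p.1, p.2 * sin p.1)%R.
have mpolar : measurable_fun [set: R * R]
    (fun p : R * R => (p.2 * cos p.1, p.2 * sin p.1)%R).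
  by apply: measurable_fun_pair; apply: measurable_funM => //;
    apply: measurableT_comp => //; apply: continuous_measurable_fun;
    [exact: continuous_cos|exact: continuous_sin].
have mG : measurable_fun setT G.
  apply: emeasurable_funM; first exact/measurable_EFinP.
  exact: measurableT_comp.
have mI : measurable (`[0%R, pi] : set R) by exact: measurable_itv.
have mP : measurable (`]0%R, +oo[ : set R) by exact: measurable_itv.
pose K := G \_ ([set: R] `*` `]0%R, +oo[).
have mK : measurable_fun setT K.
  apply/(measurable_restrictT _ (measurableX measurableT mP)).
  exact: measurable_funTS.
have K0 p : 0 <= K p.
  rewrite /K patchE; case: ifPn => //.
  rewrite inE/= in_itv/= andbT => -[_ p0].
  by rewrite mule_ge0// lee_fin ltW.
pose N t := \int[mu]_r K (t, r).
have mN : measurable_fun setT N by exact: measurable_tonelli1.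
have N0 t : 0 <= N t by exact: integral_ge0.
have half t : \int[mu]_r (`|r|%:E * F (r * cos t, r * sin t)%R) = 2%:E * N t.
  rewrite ge0_integral_even; last 3 first.
  - apply: emeasurable_funM.
      by apply/measurable_EFinP; exact: normr_measurable.
    apply: measurableT_comp => //; apply: measurable_fun_pair;
      exact: measurable_funM.
  - by move=> r; rewrite mule_ge0.
  - by move=> r; rewrite normrN !mulNr FN.
  congr (_ * _); rewrite integral_mkcond; apply: eq_integral => r _.
  rewrite /K !patchE in_setX in_setT/=; case: ifPn => //.
  by rewrite inE/= in_itv/= andbT => r0; rewrite gtr0_norm.
rewrite ge0_integral_angle// integral_mkcond.
pose M t := \int[mu]_r (`|r|%:E * F (r * sin t, r * cos t)%R).
have mM : measurable_fun setT M.
  apply: (measurable_tonelli1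
    (F := fun p => `|p.2|%:E * F (p.2 * sin p.1, p.2 * cos p.1)%R)).
    apply: emeasurable_funM.
      by apply/measurable_EFinP; apply: measurableT_comp.
    apply: (measurableT_comp mF); apply: measurable_fun_pair.
      exact: (measurableT_comp measurable_snd mpolar).
    exact: (measurableT_comp measurable_fst mpolar).
  by move=> p; rewrite mule_ge0.
have M0 t : 0 <= M t by apply: integral_ge0 => r _; rewrite mule_ge0.
rewrite -/M (@ge0_integral_affine _ (-1) (pi / 2)); first last.
- by move=> t; rewrite patchE; case: ifPn.
- apply/(measurable_restrictT _ (measurable_itv _)); exact: measurable_funTS.
- by rewrite oppr_eq0.
transitivity (\int[mu]_(t in `]0%R, pi[) (2%:E * N t)).
  rewrite [RHS]integral_mkcond; apply: eq_integral => t _.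
  rewrite normrN1 mul1e !patchE.
  have -> : ((-1 * t + pi / 2)%R \in `](- (pi / 2))%R, (pi / 2)%R[%classic) =
            (t \in `]0%R, pi[%classic).
    apply/idP/idP; rewrite !inE/= !in_itv/= => /andP[? ?];
    by apply/andP; split; lra.
  case: ifPn => // _; rewrite -half /M; apply: eq_integral => r _.
  have -> : (-1 * t + pi / 2 = - (t - pi / 2))%R by ring.
  by rewrite sinN cosN sinBpihalf cosBpihalf opprK.
rewrite -(integral_itv_bndoo true false); last first.
  apply: measurable_funTS; exact: emeasurable_funM.
rewrite ge0_integralZl//; last exact: measurable_funTS.
congr (_ * _).
rewrite integral_mkcond [RHS]integral_mkcond tonelli12; last 2 first.
- apply/(measurable_restrictT _ (measurableX mI mP)); exact: measurable_funTS.
- move=> p; rewrite patchE; case: ifPn => //.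
  rewrite inE/= => -[_]; rewrite /= in_itv/= andbT => p0.
  by rewrite mule_ge0// lee_fin ltW.
apply: eq_integral => t _; rewrite patchE /N.
have [tI|tI] := boolP (t \in _).
  apply: eq_integral => r _; rewrite /K !patchE !in_setX/= tI.
  by rewrite in_setT.
by rewrite integral0_eq// => r _; rewrite patchE in_setX/= (negbTE tI).
Qed.

End polar_coordinates.

Section Rintegral_fubini.
Context d1 d2 (T1 : measurableType d1) (T2 : measurableType d2) (R : realType).
Variables (m1 : {sigma_finite_measure set T1 -> \bar R}).
Variables (m2 : {sigma_finite_measure set T2 -> \bar R}).
Variable f : T1 * T2 -> R.
Hypothesis intf : (m1 \x m2)%E.-integrable setT (EFin \o f).

(** The inner real integral is 0 by convention where the inner extended
    integral is infinite, but this happens only on a null set. *)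
Lemma Rintegral_fubini1 :
  \int[m1]_x \int[m2]_y f (x, y) = \int[(m1 \x m2)%E]_z f z.
Proof.
rewrite /Rintegral -(integral12_prod_meas1 intf)/=; congr fine.
have intF := integrable_fubini_F intf.
have mF := measurable_int _ intF.
apply: ae_eq_integral => //.
  by apply/measurable_EFinP; exact: (measurableT_comp (@fine_measurable _ _ measurableT) mF).
have := integrable_ae measurableT intF.
apply: filterS => x /= + _ => /(_ Logic.I) Ffin.
by rewrite fineK.
Qed.

Lemma integrable_fubini2 : m2.-integrable setT (fun y => \int[m1]_x (f (x, y))%:E)%E.
Proof.
have mf := measurable_int _ intf.
apply/integrableP; split; first exact: (measurable_fubini_G intf).
apply: le_lt_trans ((integrable21ltyP m1 m2 mf).1 intf).
apply: ge0_le_integral => //.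
- apply: measurableT_comp => //; exact: (measurable_fubini_G intf).
- apply: (measurable_fun_fubini_tonelli_G (m1 := m1) (fun z => `|(f z)%:E|%E)) => //.
  exact: measurableT_comp.
- move=> y _; apply: (le_abse_integral m1 measurableT).
  exact: (measurableT_comp mf (measurable_pair2 y)).
Qed.

Lemma Rintegral_fubini2 :
  \int[m2]_y \int[m1]_x f (x, y) = \int[(m1 \x m2)%E]_z f z.
Proof.
rewrite /Rintegral -(integral21_prod_meas1 intf)/=; congr fine.
have intF := integrable_fubini2.
have mF := measurable_int _ intF.
apply: ae_eq_integral => //.
  by apply/measurable_EFinP; exact: (measurableT_comp (@fine_measurable _ _ measurableT) mF).
have := integrable_ae measurableT intF.
apply: filterS => x /= + _ => /(_ Logic.I) Ffin.
by rewrite fineK.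
Qed.

End Rintegral_fubini.

Section signed_polar_coordinates.
Context {R : realType}.
Notation mu := (@lebesgue_measure R).
Variable f : R * R -> R.
Hypothesis intf : (lebesgue2 R).-integrable setT (EFin \o f).
Hypothesis fN : forall x y, f (- x, - y) = f (x, y).

Let D : set (R * R) := `[0, pi] `*` `]0, +oo[.
Let G (p : R * R) := p.2 * f (p.2 * cos p.1, p.2 * sin p.1).

Let mf : measurable_fun setT (f : R * R -> R).
Proof. by apply/measurable_EFinP; exact: (measurable_int _ intf). Qed.

Let mD : measurable D. Proof. by apply: measurableX; exact: measurable_itv. Qed.

Let mG : measurable_fun setT G.
Proof.
apply: measurable_funM => //; apply: measurableT_comp => //.
by apply: measurable_fun_pair; apply: measurable_funM => //;
  apply: measurableT_comp => //; apply: continuous_measurable_fun;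
  [exact: continuous_cos|exact: continuous_sin].
Qed.

Let ge0_polar (g : R -> R) : measurable_fun setT g -> (forall x, 0 <= g x) ->
    (forall r x, 0 < r -> g (r * x) = r * g x) ->
  (\int[lebesgue2 R]_z (g (f z))%:E =
   2%:E * \int[lebesgue2 R]_(p in D) (g (G p))%:E)%E.
Proof.
move=> mg g0 gM; rewrite (@ge0_integral_polar _ (fun z => (g (f z))%:E)).
- congr (_ * _)%E; apply: eq_integral => p; rewrite inE => -[_ /=].
  by rewrite in_itv/= andbT => p0; rewrite /G gM// EFinM.
- by apply/measurable_EFinP; exact: measurableT_comp.
- by move=> z; rewrite lee_fin.
- by move=> x y; rewrite fN.
Qed.

(** Polar coordinates for the absolute value show that the integral is
    finite. *)
Lemma integrable_polar : (lebesgue2 R).-integrable D (EFin \o G).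
Proof.
apply/integrableP; split; first by apply: measurable_funTS; exact/measurable_EFinP.
have [_] := integrableP _ _ _ intf.
have normM (r x : R) : 0 < r -> `|r * x| = r * `|x|.
  by move=> r0; rewrite normrM gtr0_norm.
have := ge0_polar (normr_measurable (D := setT)) (@normr_ge0 _ R) normM.
rewrite /= => ->.
set I := integral _ _ _.
have I0 : (0 <= I)%E by apply: integral_ge0 => p _; rewrite lee_fin normr_ge0.
case: I I0 => [I| |]//= _; first by move=> _; exact: ltry.
by rewrite mulry gtr0_sg// mul1e.
Qed.

(** The statement for nonnegative functions applies to the positive and
    negative parts, since multiplication by r > 0 commutes with taking parts. *)
Lemma Rintegral_polar :
  \int[lebesgue2 R]_z f z =
  2 * \int[mu]_(t in `[0, pi]) \int[mu]_(r in `]0, +oo[)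
        (r * f (r * cos t, r * sin t)).
Proof.
have polar_fine (g : R -> R) : measurable_fun setT g -> (forall x, 0 <= g x) ->
    (forall r x, 0 < r -> g (r * x) = r * g x) ->
    (lebesgue2 R).-integrable D (fun p => (g (G p))%:E) ->
    \int[lebesgue2 R]_z g (f z) = 2 * \int[lebesgue2 R]_(p in D) g (G p).
  move=> mg g0 gM intg; rewrite /Rintegral ge0_polar// fineM//.
  exact: integrable_fin_num.
have GE : \int[lebesgue2 R]_(p in D) G p = 2^-1 * \int[lebesgue2 R]_z f z.
  have intp : (lebesgue2 R).-integrable D (EFin \o G^\+).
    by apply: integrable_funrpos => //; exact: integrable_polar.
  have intn : (lebesgue2 R).-integrable D (EFin \o G^\-).
    by apply: integrable_funrneg => //; exact: integrable_polar.
  have -> : \int[lebesgue2 R]_z f z =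
      \int[lebesgue2 R]_z (f^\+ z) - \int[lebesgue2 R]_z (f^\- z).
    rewrite -RintegralB//; [|exact: integrable_funrpos|exact: integrable_funrneg].
    by apply: eq_Rintegral => z _; rewrite -[in LHS](funrposBneg f).
  rewrite (polar_fine (@idfun R)^\+ _ _ _ intp)//; last 2 first.
  - by apply: measurable_funrpos; exact: measurable_id.
  - by move=> r x r0; rewrite /funrpos maxr_pMr ?mulr0// ltW.
  rewrite (polar_fine (@idfun R)^\- _ _ _ intn)//; last 2 first.
  - by apply: measurable_funrneg; exact: measurable_id.
  - by move=> r x r0; rewrite /funrneg/= -mulrN maxr_pMr ?mulr0// ltW.
  have -> : \int[lebesgue2 R]_(p in D) G p =
      \int[lebesgue2 R]_(p in D) G^\+ p - \int[lebesgue2 R]_(p in D) G^\- p.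
    transitivity (\int[lebesgue2 R]_(p in D) (G^\+ p - G^\- p)).
      by apply: eq_Rintegral => p _; rewrite -[in LHS](funrposBneg G).
    by apply: RintegralB.
  by rewrite -mulrBr mulKf.
have two0 : (2 : R) != 0 by rewrite pnatr_eq0.
rewrite -[LHS](mulVKf two0) -GE; congr (_ * _).
rewrite Rintegral_mkcond -(Rintegral_fubini1 (m1 := mu) (m2 := mu) (f := G \_ D)).
  rewrite [RHS]Rintegral_mkcond; apply: eq_Rintegral => t _.
  rewrite patchE; case: ifPn => tI.
    rewrite [RHS]Rintegral_mkcond; apply: eq_Rintegral => r _.
    by rewrite !patchE in_setX/= tI.
  rewrite /Rintegral integral0_eq// => r _.
  by rewrite patchE in_setX/= (negbTE tI).
rewrite -restrict_EFin; apply/integrable_restrict => //.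
by rewrite setTI; exact: integrable_polar.
Qed.

End signed_polar_coordinates.

(** * Hat functions and the cubic B-spline *)

Section tent_correlation.
Context {R : realType}.
Notation mu := (@lebesgue_measure R).
Implicit Types t x : R.

(** Truncated powers have one-line derivatives valid across their knot, so
    splines written with them can be integrated without splitting cases. *)
Definition truncated_pow n x : R := Num.max x 0 ^+ n.

Lemma continuous_truncated_pow n : continuous (truncated_pow n).
Proof.
move=> x.
have cmax : {for x, continuous (id \max cst 0 : R -> R)}.
  by apply: continuous_max => //; exact: cst_continuous.
exact: (continuous_comp cmax (@exprn_continuous R n _)).
Qed.

Lemma is_derive_truncated_pow n x :
  is_derive x 1 (truncated_pow n.+2) (n.+2%:R * truncated_pow n.+1 x).
Proof.
have [x0|x0|x0] := ltgtP x 0.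
- apply: (@near_eq_is_derive _ _ _ (cst 0)).
    near=> y; rewrite /truncated_pow max_r ?expr0n//.
    suff : (y : R) < 0 by move/ltW.
    by near: y; exact: lt_nbhsl.
  by rewrite /truncated_pow max_r ?(ltW x0)// expr0n mulr0; exact: is_derive_cst.
- apply: (@near_eq_is_derive _ _ _ ((@id R) ^+ n.+2)).
    near=> y; rewrite exprfctE /truncated_pow max_l//.
    suff : 0 < (y : R) by move/ltW.
    by near: y; exact: lt_nbhsr.
  rewrite /truncated_pow max_l ?(ltW x0)//.
  by apply: is_derive_eq; rewrite /GRing.scale/= mulr1.
(* At the knot the difference quotient is itself a truncated power. *)
- rewrite x0 {2}/truncated_pow maxxx expr0n mulr0.
  have lim0 : (fun h : R => h^-1 *: ((truncated_pow n.+2 \o shift 0) (h *: 1) -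
      truncated_pow n.+2 0)) @ 0^' --> (0 : R).
    apply: (@cvg_trans _ (truncated_pow n.+1 @ 0^')).
      apply: near_eq_cvg; near=> h.
      have h0 : h != 0 by near: h; exact: nbhs_dnbhs_neq.
      rewrite /= /shift /GRing.scale/= mulr1 addr0 /truncated_pow maxxx.
      rewrite expr0n subr0; case: (ltP h 0) => hle.
        by rewrite !expr0n mulr0.
      by rewrite (exprS _ n.+1) mulKf.
    have := @continuous_truncated_pow n.+1 (0 : R).
    rewrite /continuous_at {2}/truncated_pow maxxx expr0n => ct.
    exact: cvg_within_filter.
  apply: DeriveDef; first by apply/cvg_ex; exists 0.
  exact: cvg_lim.
Unshelve. all: by end_near. Qed.

Definition tent x : R := Num.max (1 - `|x|) 0.

Lemma tentE x : tent x =
  truncated_pow 1 (x + 1) - 2 * truncated_pow 1 x + truncated_pow 1 (x - 1).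
Proof.
rewrite /tent /truncated_pow !expr1.
have [x0|x0] : 0 <= x \/ x < 0 by case: (leP 0 x); [left|right].
  rewrite ger0_norm// [Num.max x 0]max_l// [Num.max (x + 1) 0]max_l; last lra.
  have [x1|x1] : x <= 1 \/ 1 <= x by case: (leP x 1) => [|/ltW]; [left|right].
    by rewrite max_l ?[Num.max _ _]max_r; lra.
  by rewrite max_r ?[Num.max _ _]max_l; lra.
rewrite ltr0_norm// [Num.max x 0]max_r ?[Num.max (x - 1) 0]max_r; [|lra..].
by rewrite opprK addrC; lra.
Qed.

(** A cubic spline is determined by the jumps of its third derivative: those of
    B3 are the alternating binomial coefficients 1, -4, 6, -4, 1. *)
Lemma B3E t : B3 (2 + t) =
  (truncated_pow 3 (t + 2) - 4 * truncated_pow 3 (t + 1)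
   + 6 * truncated_pow 3 t - 4 * truncated_pow 3 (t - 1)
   + truncated_pow 3 (t - 2)) / 6.
Proof.
have pos x : 0 <= x -> truncated_pow 3 x = x ^+ 3.
  by move=> x0; rewrite /truncated_pow max_l.
have neg x : x <= 0 -> truncated_pow 3 x = 0.
  by move=> x0; rewrite /truncated_pow max_r// expr0n.
rewrite /B3.
have [t1|t1] := ltP t (-2).
  rewrite !ifF; [|apply/negbTE/negP => /andP[]; lra..].
  by rewrite !neg; [ring|lra..].
have [t2|t2] := ltP t (-1).
  rewrite ifT; last by apply/andP; split; lra.
  by rewrite pos ?neg; [field|lra..].
have [t3|t3] := ltP t 0.
  rewrite ifF; last by apply/negbTE/negP => /andP[]; lra.
  rewrite ifT; last by apply/andP; split; lra.
  rewrite (pos (t + 2)); last lra.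
  rewrite (pos (t + 1)); last lra.
  by rewrite !neg; [field|lra..].
have [t4|t4] := ltP t 1.
  rewrite ifF; last by apply/negbTE/negP => /andP[]; lra.
  rewrite ifF; last by apply/negbTE/negP => /andP[]; lra.
  rewrite ifT; last by apply/andP; split; lra.
  rewrite (neg (t - 1)); last lra.
  rewrite (neg (t - 2)); last lra.
  by rewrite !pos; [field|lra..].
have [t5|t5] := ltP t 2.
  rewrite ifF; last by apply/negbTE/negP => /andP[]; lra.
  rewrite ifF; last by apply/negbTE/negP => /andP[]; lra.
  rewrite ifF; last by apply/negbTE/negP => /andP[]; lra.
  rewrite ifT; last by apply/andP; split; lra.
  rewrite (neg (t - 2)); last lra.
  by rewrite !pos; [field|lra..].
rewrite !ifF; [|apply/negbTE/negP => /andP[]; lra..].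
by rewrite !pos; [field|lra..].
Qed.

(** Replacing x_+^3 by (-x)_+^3 changes it by x^3, and the fourth difference of
    a cubic polynomial is zero. *)
Lemma B3_sym t : B3 (2 - t) = B3 (2 + t).
Proof.
have tN x : truncated_pow 3 (- x) = truncated_pow 3 x - x ^+ 3.
  rewrite /truncated_pow; have [x0|/ltW x0] : 0 <= x \/ x < 0 by case: (leP 0 x); [left|right].
    by rewrite max_r ?oppr_le0// max_l// expr0n subrr.
  by rewrite max_l ?oppr_ge0// max_r//; ring.
rewrite !B3E (_ : - t + 2 = - (t - 2)); last by ring.
rewrite (_ : - t + 1 = - (t - 1)); last by ring.
rewrite (_ : - t - 1 = - (t + 1)); last by ring.
rewrite (_ : - t - 2 = - (t + 2)); last by ring.
by rewrite !tN; field.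
Qed.

(** tent1 and tent2 are iterated primitives of tent, which is itself a second
    difference of the truncated first power (tentE). *)
Let tent1 t : R :=
  (truncated_pow 2 (t + 1) - 2 * truncated_pow 2 t + truncated_pow 2 (t - 1)) / 2.
Let tent2 t : R :=
  (truncated_pow 3 (t + 1) - 2 * truncated_pow 3 t + truncated_pow 3 (t - 1)) / 6.

Let is_derive_truncated_pow_shift n c x :
  is_derive x 1 (fun y => truncated_pow n.+2 (y + c)) (n.+2%:R * truncated_pow n.+1 (x + c)).
Proof.
have d : is_derive x 1 (shift c) (1 : R) by exact: is_derive_shift.
have := is_derive1_comp (g := shift c) (is_derive_truncated_pow n (x + c)) d.
by rewrite mulr1.
Qed.

Let is_derive_tent1 t x : is_derive x 1 (fun y => tent1 (y + t)) (tent (x + t)).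
Proof.
have d c := is_derive_truncated_pow_shift 0 c x.
have D : is_derive x 1
    (fun y : R => 2^-1 * truncated_pow 2 (y + (t + 1))
       - 1 * truncated_pow 2 (y + t)
       + 2^-1 * truncated_pow 2 (y + (t - 1)))
    (2^-1 * (2%:R * truncated_pow 1 (x + (t + 1)))
       - 1 * (2%:R * truncated_pow 1 (x + t))
       + 2^-1 * (2%:R * truncated_pow 1 (x + (t - 1)))) :=
  is_deriveD (is_deriveB (is_deriveZ 2^-1 (d (t + 1))) (is_deriveZ 1 (d t)))
  (is_deriveZ 2^-1 (d (t - 1))).
rewrite (_ : (fun y => tent1 (y + t)) = fun y => 2^-1 * truncated_pow 2 (y + (t + 1))
    - 1 * truncated_pow 2 (y + t) + 2^-1 * truncated_pow 2 (y + (t - 1))); last first.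
  by apply/funext => y; rewrite /tent1 !addrA; field.
apply: is_derive_eq D _; rewrite tentE !addrA; by field.
Qed.

Let is_derive_tent2 t x : is_derive x 1 (fun y => tent2 (y + t)) (tent1 (x + t)).
Proof.
have d c := is_derive_truncated_pow_shift 1 c x.
have D : is_derive x 1
    (fun y : R => 6^-1 * truncated_pow 3 (y + (t + 1))
       - 3^-1 * truncated_pow 3 (y + t)
       + 6^-1 * truncated_pow 3 (y + (t - 1)))
    (6^-1 * (3%:R * truncated_pow 2 (x + (t + 1)))
       - 3^-1 * (3%:R * truncated_pow 2 (x + t))
       + 6^-1 * (3%:R * truncated_pow 2 (x + (t - 1)))) :=
  is_deriveD (is_deriveB (is_deriveZ 6^-1 (d (t + 1))) (is_deriveZ 3^-1 (d t)))
  (is_deriveZ 6^-1 (d (t - 1))).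
rewrite (_ : (fun y => tent2 (y + t)) = fun y => 6^-1 * truncated_pow 3 (y + (t + 1))
    - 3^-1 * truncated_pow 3 (y + t) + 6^-1 * truncated_pow 3 (y + (t - 1))); last first.
  by apply/funext => y; rewrite /tent2 !addrA; field.
apply: is_derive_eq D _; rewrite /tent1 !addrA; by field.
Qed.

Lemma continuous_tent : continuous tent.
Proof.
move=> x; apply: (@continuous_max _ _ (fun y : R => 1 - `|y|) (cst 0)).
  apply: continuousB; first exact: cst_continuous.
  exact: norm_continuous.
exact: cst_continuous.
Qed.

Lemma tent_ge0 x : 0 <= tent x.
Proof. by rewrite /tent le_max lexx orbT. Qed.

Lemma measurable_tent : measurable_fun setT tent.
Proof. by apply: continuous_measurable_fun; exact: continuous_tent. Qed.

(** Integration by parts twice on each of [-1, 0] and [0, 1], where tent is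
    affine, leaves tent2 (t + 1) - 2 tent2 t + tent2 (t - 1), and this second
    difference of a second difference is the fourth difference of B3E. *)
Lemma integral_tent_tent t :
  (\int[mu]_x (tent x * tent (x + t))%:E = (B3 (2 + t))%:E)%E.
Proof.
have ct a b (c : R) : {in `[a, b], continuous (fun x => (1 + c * x) * tent (x + t))}.
  move=> x _; apply: cvgM.
    by apply: cvgD; [exact: cvg_cst|apply: cvgM; [exact: cvg_cst|exact: cvg_id]].
  have cs : {for x, continuous (shift t)}.
    by apply: cvgD; [exact: cvg_id|exact: cvg_cst].
  exact: (continuous_comp cs (@continuous_tent _)).
have dx x c : is_derive x 1 (fun y : R => 1 + c * y) c.
  have D : is_derive x 1 (fun y : R => 1 + c * y) (0 + c * 1) :=
    is_deriveD (is_derive_cst (1 : R) x 1) (is_deriveZ c (is_derive_id x (1 : R))).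
  by rewrite add0r mulr1 in D.
have neg1_lt0 : (-1 : R) < 0 by rewrite ltrN10.
have left_half : (\int[mu]_(x in `[(-1)%R, 0%R]) ((1 + 1 * x) * tent (x + t))%:E =
    (tent1 t - tent2 t + tent2 (t - 1))%:E)%E.
  rewrite (@integral_derivative _
    (fun x => (1 + 1 * x) * tent1 (x + t) - tent2 (x + t)) _ _ _ neg1_lt0 _ (@ct _ _ _)).
  - by rewrite !add0r [-1 + t]addrC; congr EFin; ring.
  - move=> x _.
    have D : is_derive x 1 (fun x => (1 + 1 * x) * tent1 (x + t) - tent2 (x + t))
        ((1 + 1 * x) * tent (x + t) + tent1 (x + t) * 1 - tent1 (x + t)) :=
      is_deriveB (is_deriveM (dx x 1) (is_derive_tent1 t x)) (is_derive_tent2 t x).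
    by rewrite mulr1 addrK in D.
have right_half : (\int[mu]_(x in `[0%R, 1%R]) ((1 + (-1) * x) * tent (x + t))%:E =
    (tent2 (t + 1) - tent1 t - tent2 t)%:E)%E.
  rewrite (@integral_derivative _
    (fun x => (1 + (-1) * x) * tent1 (x + t) + tent2 (x + t)) _ _ _ ltr01 _ (@ct _ _ _)).
  - by rewrite !add0r [1 + t]addrC; congr EFin; ring.
  - move=> x _.
    have D : is_derive x 1 (fun x => (1 + (-1) * x) * tent1 (x + t) + tent2 (x + t))
        ((1 + (-1) * x) * tent (x + t) + tent1 (x + t) * -1 + tent1 (x + t)) :=
      is_deriveD (is_deriveM (dx x (-1)) (is_derive_tent1 t x)) (is_derive_tent2 t x).
    by rewrite mulrN1 addrNK in D.
have supp x : x \notin `[-1, 1] -> tent x = 0.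
  rewrite in_itv/= negb_and -!ltNge => x1; apply/max_r.
  rewrite subr_le0; case/orP: x1 => x1.
    by rewrite ltr0_norm; lra.
  by rewrite gtr0_norm; lra.
have mtt : measurable_fun setT (fun x => (tent x * tent (x + t))%:E).
  apply/measurable_EFinP; apply: measurable_funM; first exact: measurable_tent.
  by apply: measurableT_comp; [exact: measurable_tent|exact: measurable_funD].
transitivity (\int[mu]_(x in `[(-1)%R, 1%R]) (tent x * tent (x + t))%:E)%E.
  rewrite [RHS]integral_mkcond; apply: eq_integral => x _.
  rewrite patchE; case: ifPn => // xn.
  by rewrite supp ?mul0r//; apply: contra xn; rewrite inE.
have -> : `[(-1)%R, 1%R]%classic = `[(-1)%R, 0%R] `|` `]0%R, 1%R] :> set R.
  apply/seteqP; split => x /=; rewrite !in_itv/=.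
    by move=> /andP[x1 x2]; case: (leP x 0) => x0; [left|right]; apply/andP; split.
  by move=> [] /andP[x1 x2]; apply/andP; split; lra.
have mneg : measurable (`[(-1)%R, 0%R] : set R) by exact: measurable_itv.
have mpos : measurable (`]0%R, 1%R] : set R) by exact: measurable_itv.
rewrite ge0_integral_setU//; first last.
- apply/disj_setPS => x [/=]; rewrite !in_itv/= => /andP[_ xn] /andP[xp _].
  by have := lt_le_trans xp xn; rewrite ltxx.
- by move=> x _; rewrite lee_fin mulr_ge0 ?tent_ge0.
- exact: measurable_funTS.
rewrite (integral_itv_obnd_cbnd (measurable_funTS mtt)).
transitivity ((tent1 t - tent2 t + tent2 (t - 1))%:E
    + (tent2 (t + 1) - tent1 t - tent2 t)%:E)%E.
  rewrite -left_half -right_half; congr (_ + _)%E;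
    apply: eq_integral => x; rewrite inE/= in_itv/= => /andP[x1 x2]; congr (_ * _)%:E.
    by rewrite /tent ler0_norm// opprK mul1r max_l//; lra.
  by rewrite /tent ger0_norm// mulN1r max_l//; lra.
rewrite -EFinD; congr EFin; rewrite /tent2 B3E -!addrA.
rewrite (_ : 1 + 1 = 2 :> R); last by ring.
rewrite (_ : - 1 - 1 = - 2 :> R); last by ring.
rewrite addNr subrr !addr0; by field.
Qed.

Lemma hatE (a h : R) n x : 0 < h -> (0 < n)%N ->
  hat a h n x = tent ((x - grid_point a h n) / h).
Proof.
case: n => // n h0 _; rewrite /hat.
set c := grid_point a h n.+1.
have -> : grid_point a h n.+1.-1 = c - h.
  by rewrite /c /grid_point /= -[in RHS]natr1; ring.
have -> : grid_point a h n.+2 = c + h.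
  by rewrite /c /grid_point -[in LHS]natr1; ring.
have xE : x = c + h * ((x - c) / h) by field; rewrite gt_eqF.
move: xE; set y := (x - c) / h => ->.
have -> : (c - h < c + h * y <= c) = (-1 < y <= 0).
  by apply/idP/idP => /andP[? ?]; apply/andP; split; nra.
have -> : (c < c + h * y < c + h) = (0 < y < 1).
  by apply/idP/idP => /andP[? ?]; apply/andP; split; nra.
rewrite /tent; case: ifPn => [/andP[y1 y2]|yn].
  rewrite ler0_norm// max_l; last lra.
  by field; rewrite gt_eqF.
case: ifPn => [/andP[y1 y2]|yn'].
  rewrite gtr0_norm// max_l; last lra.
  by field; rewrite gt_eqF.
rewrite max_r// subr_le0.
move: yn yn'; rewrite !negb_and -!leNgt -!ltNge.
move=> /orP[y1|y1] /orP[y2|y2].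
- by rewrite ler0_norm; lra.
- by rewrite ltr0_norm; lra.
- by lra.
- by rewrite gtr0_norm.
Qed.

Lemma hat_ge0 (a h : R) n x : 0 < h -> (0 < n)%N -> 0 <= hat a h n x.
Proof. by move=> h0 n0; rewrite hatE// tent_ge0. Qed.

Lemma measurable_hat (a h : R) n : 0 < h -> (0 < n)%N -> measurable_fun setT (hat a h n).
Proof.
move=> h0 n0.
have -> : hat a h n = tent \o (fun x => (x - grid_point a h n) / h).
  by apply/funext => x; rewrite hatE.
apply: measurableT_comp; first exact: measurable_tent.
by apply: measurable_funM => //; exact: measurable_funB.
Qed.

(** The substitution x = h y + (node of n) - al reduces the claim to a tent
    centred at 0 and a tent shifted by the distance of the two nodes in units
    of h. *)
Lemma integral_hat_hat (a h : R) n m (al be : R) :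
  0 < h -> (0 < n)%N -> (0 < m)%N ->
  (\int[mu]_x (hat a h n (x + al) * hat a h m (x + be))%:E =
   (h * B3 (2 + (n%:R - m%:R + (be - al) / h)))%:E)%E.
Proof.
move=> h0 n0 m0.
have mhat k c : (0 < k)%N -> measurable_fun setT (fun x => hat a h k (x + c)).
  move=> k0; apply: measurableT_comp; first exact: measurable_hat.
  exact: measurable_funD.
rewrite (ge0_integral_affine (grid_point a h n - al) (negbT (gt_eqF h0))); last 2 first.
- by apply/measurable_EFinP; apply: measurable_funM; exact: mhat.
- by move=> x; rewrite lee_fin mulr_ge0// hat_ge0.
under eq_integral => x _.
  rewrite !hatE//.
  rewrite [X in tent X * _](_ : _ = x); last first.
    by field; rewrite gt_eqF.
  rewrite [X in _ * tent X](_ : _ = x + (n%:R - m%:R + (be - al) / h)); last first.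
    by rewrite /grid_point; field; rewrite gt_eqF.
  over.
rewrite ge0_integralZl//; first by rewrite integral_tent_tent gtr0_norm// EFinM.
- apply/measurable_EFinP; apply: measurable_funM; first exact: measurable_tent.
  by apply: measurableT_comp; [exact: measurable_tent|exact: measurable_funD].
- by move=> x _; rewrite lee_fin mulr_ge0// tent_ge0.
Qed.

End tent_correlation.

(** * Reflection of the plane *)

Section reflection.
Context {R : realType}.
Notation mu := (@lebesgue_measure R).

Let reflect (s : measurableTypeR R * measurableTypeR R) :
  measurableTypeR R * measurableTypeR R := (- s.1, s.2).

Let measurable_reflect : measurable_fun setT reflect.
Proof. by apply: measurable_fun_pair => //; exact: measurableT_comp. Qed.

(** Two measures that agree on rectangles agree. *)
Let reflectK (A : set (measurableTypeR R * measurableTypeR R)) : measurable A ->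
  pushforward (lebesgue2 R) reflect A = lebesgue2 R A.
Proof.
move=> mA; rewrite /lebesgue2; apply/esym.
apply: (@product_measure_unique _ _ _ _ R mu mu) => // X Y mX mY.
rewrite -[LHS]/((mu \x mu)%E ((-%R @^-1` X) `*` Y)).
have mNX : measurable (-%R @^-1` X : set R).
  by rewrite -[X in measurable X]setTI; exact: oppr_measurable.
rewrite product_measure1E//; congr (_ * _)%E.
exact: lebesgue_measureN.
Qed.

Lemma integrable_reflect (f : R * R -> R) :
  (lebesgue2 R).-integrable setT (EFin \o f) ->
  (lebesgue2 R).-integrable setT (fun s => (f (- s.1, s.2))%:E).
Proof.
move=> intf; have mf := measurable_int _ intf.
apply/integrableP; split; first exact: (measurableT_comp mf measurable_reflect).
have [_ ffin] := integrableP _ _ _ intf.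
apply: le_lt_trans ffin.
rewrite le_eqVlt; apply/orP; left; apply/eqP.
transitivity (\int[pushforward (lebesgue2 R) reflect]_s `|(f s)%:E|)%E.
  by rewrite ge0_integral_pushforward//; exact: measurableT_comp.
by apply: eq_measure_integral => A mA _; exact: reflectK.
Qed.

Lemma Rintegral_reflect (f : R * R -> R) :
  (lebesgue2 R).-integrable setT (EFin \o f) ->
  \int[lebesgue2 R]_s f (- s.1, s.2) = \int[lebesgue2 R]_s f s.
Proof.
move=> intf; rewrite /Rintegral; congr fine.
transitivity (\int[pushforward (lebesgue2 R) reflect]_s (f s)%:E)%E.
  rewrite integral_pushforward//; first exact: (measurable_int _ intf).
  exact: integrable_reflect.
by apply: eq_measure_integral => A mA _; exact: reflectK.
Qed.

End reflection.

(** * The kernel *)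

Section kernel.
Context {R : realType}.
Implicit Types s : R * R.

Lemma eucl_norm_ge0 s : 0 <= eucl_norm s.
Proof. exact: sqrtr_ge0. Qed.

Lemma eucl_norm_eq0 s : eucl_norm s = 0 -> s = 0.
Proof.
move=> /eqP; rewrite sqrtr_eq0 => s0.
have s10 : 0 <= s.1 ^+ 2 by exact: sqr_ge0.
have s20 : 0 <= s.2 ^+ 2 by exact: sqr_ge0.
have /eqP : s.1 ^+ 2 = 0 by lra.
have /eqP : s.2 ^+ 2 = 0 by lra.
by rewrite !sqrf_eq0 => /eqP + /eqP; case: s {s0 s10 s20} => x y /= -> ->.
Qed.

Lemma ler_fst_eucl_norm s : `|s.1| <= eucl_norm s.
Proof. by rewrite -sqrtr_sqr ler_wsqrtr// lerDl sqr_ge0. Qed.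

Lemma ler_snd_eucl_norm s : `|s.2| <= eucl_norm s.
Proof. by rewrite -sqrtr_sqr ler_wsqrtr// lerDr sqr_ge0. Qed.

Lemma measurable_eucl_norm : measurable_fun setT (@eucl_norm R : R * R -> R).
Proof.
apply: measurableT_comp.
  by apply: continuous_measurable_fun; exact: sqrt_continuous.
by apply: measurable_funD; apply: measurable_funX.
Qed.

Variables (delta : R) (rho : R -> R).
Hypothesis rho_mono : forall r s : R, 0 < r -> r <= s -> s < delta -> rho s <= rho r.

(** Extension by zero gives a kernel measurable on the whole line and turns
    integrals over the disc into integrals over the plane.  At s = 0, where the
    extension may differ from rho, the integrands vanish. *)
Definition cut_kernel : R -> R := rho \_ `]0, delta[.

(** Superlevel sets of a monotone function on an interval are intervals. *)
Lemma measurable_cut_kernel : measurable_fun setT cut_kernel.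
Proof.
have mD : measurable (`]0, delta[ : set R) by exact: measurable_itv.
apply/(measurable_restrictT _ mD).
apply: (measurability _ (RGenOInfty.measurableE R)) => _ [_ [c ->] <-].
apply: is_interval_measurable => x z /= [+ cx] [+ cz] y /andP[xy yz].
rewrite !in_itv/= !andbT in cx cz *.
move=> /andP[x0 xd] /andP[z0 zd]; split.
  by rewrite (lt_le_trans x0 xy) (le_lt_trans yz zd).
by rewrite (lt_le_trans cz)// rho_mono// (lt_le_trans x0).
Qed.

Lemma integral_disc_kernel (g : R * R -> R) : g 0 = 0 ->
  (\int[lebesgue2 R]_(s in disc delta) (g s * rho (eucl_norm s))%:E =
   \int[lebesgue2 R]_s (g s * cut_kernel (eucl_norm s))%:E)%E.
Proof.
move=> g0; rewrite integral_mkcond; apply: eq_integral => s _.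
rewrite patchE /cut_kernel patchE.
have -> : (s \in disc delta) = (eucl_norm s < delta).
  by apply/idP/idP; rewrite inE.
have -> : (eucl_norm s \in `]0, delta[%classic) = (0 < eucl_norm s < delta).
  by apply/idP/idP; rewrite inE/= in_itv.
case: ifPn => [sd|nsd]; last by rewrite andbF mulr0.
rewrite andbT lt_neqAle eucl_norm_ge0 andbT; case: eqP => //= /esym/eucl_norm_eq0 ->.
by rewrite g0 !mul0r.
Qed.

Hypothesis rho_norm : (\int[lebesgue2 R]_(s in disc delta)
  (rho (eucl_norm s) * eucl_norm s ^+ 2)%:E = 2%:E)%E.

(** rho may change sign, so finiteness of the integral is what forces both
    parts to be finite. *)
Lemma integrable_kernel : (lebesgue2 R).-integrable setT
  (fun s => (eucl_norm s ^+ 2 * cut_kernel (eucl_norm s))%:E).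
Proof.
have mk : measurable_fun setT
    (fun s : R * R => eucl_norm s ^+ 2 * cut_kernel (eucl_norm s)).
  apply: measurable_funM.
    by apply: measurable_funX; exact: measurable_eucl_norm.
  apply: measurableT_comp; [exact: measurable_cut_kernel|exact: measurable_eucl_norm].
have E : (\int[lebesgue2 R]_s (eucl_norm s ^+ 2 * cut_kernel (eucl_norm s))%:E
    = 2%:E)%E.
  rewrite -rho_norm -integral_disc_kernel; last first.
    by rewrite /eucl_norm/= expr0n/= addr0 sqrtr0 expr0n.
  by apply: eq_integral => s _; rewrite mulrC.
apply/integrableP; split; first by apply/measurable_EFinP.
rewrite integral_fin_num_abs//.
  by rewrite E.
Qed.

End kernel.

(** * Basis functions *)

Section basis.
Context {R : realType}.
Notation mu := (@lebesgue_measure R).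
Implicit Types x y s : R * R.
Local Notation basis := Defs.basis.

Lemma tent_lipschitz (x y : R) : `|tent x - tent y| <= `|x - y|.
Proof.
have := ler_dist_dist x y; set d := `|x - y|.
rewrite /tent !ler_norml => /andP[d1 d2].
have [x1|x1] : 0 <= 1 - `|x| \/ 1 - `|x| <= 0.
  by case: (leP 0 (1 - `|x|)) => [|/ltW]; [left|right].
all: have [y1|y1] : 0 <= 1 - `|y| \/ 1 - `|y| <= 0
  by case: (leP 0 (1 - `|y|)) => [|/ltW]; [left|right].
- by rewrite !max_l//; apply/andP; split; lra.
- by rewrite max_l// max_r//; apply/andP; split; lra.
- by rewrite max_r// max_l//; apply/andP; split; lra.
- by rewrite !max_r//; apply/andP; split; lra.
Qed.

Lemma tent_le1 (x : R) : tent x <= 1.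
Proof. by rewrite /tent ge_max ler01 andbT lerBlDr lerDl. Qed.

Lemma hat_lipschitz (a h : R) n (x y : R) : 0 < h -> (0 < n)%N ->
  `|hat a h n x - hat a h n y| <= `|x - y| / h.
Proof.
move=> h0 n0; rewrite !hatE//; apply: (le_trans (tent_lipschitz _ _)).
rewrite -mulrBl opprB addrA subrK normrM [`|h^-1|]gtr0_norm// invr_gt0//.
Qed.

Lemma hat_support (a b h : R) N n (x : R) : 0 < h -> (0 < n <= N)%N ->
  b = a + (N + 1)%:R * h -> hat a h n x != 0 -> a < x < b.
Proof.
move=> h0 /andP[n0 nN] ->; rewrite /hat /grid_point.
have n1 : (0 : R) <= n.-1%:R by rewrite ler0n.
have nE : (n%:R : R) = n.-1%:R + 1 by rewrite natr1 prednK.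
have n2 : (n.+1%:R : R) <= (N + 1)%:R by rewrite ler_nat addn1 ltnS.
have n3 : (n.+1%:R : R) = n%:R + 1 by rewrite natr1.
case: ifPn => [/andP[x1 x2] _|_].
  by apply/andP; split; nra.
case: ifPn => [/andP[x1 x2] _|_]; last by rewrite eqxx.
by apply/andP; split; nra.
Qed.

Variables (a1 a2 b1 b2 h : R) (N1 N2 : nat).
Hypotheses (h0 : 0 < h).
Hypotheses (b1E : b1 = a1 + (N1 + 1)%:R * h) (b2E : b2 = a2 + (N2 + 1)%:R * h).

Lemma basis_lipschitz n1 n2 x s : (0 < n1)%N -> (0 < n2)%N ->
  `|basis a1 a2 h n1 n2 (x + s) - basis a1 a2 h n1 n2 x| <= 2 / h * eucl_norm s.
Proof.
move=> n10 n20; rewrite /basis /=.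
set p := hat a1 h n1 (x.1 + s.1); set p' := hat a1 h n1 x.1.
set q := hat a2 h n2 (x.2 + s.2); set q' := hat a2 h n2 x.2.
have -> : p * q - p' * q' = (p - p') * q + p' * (q - q') by ring.
have lip (c d e : R) (t : R) : `|d - c| <= `|t| / h -> 0 <= e <= 1 ->
    `|t| <= eucl_norm s -> `|(d - c) * e| <= h^-1 * eucl_norm s.
  move=> dc /andP[e0 e1] ts; rewrite normrM (ger0_norm e0).
  apply: (@le_trans _ _ `|d - c|); first by rewrite ler_piMr.
  apply: (le_trans dc); rewrite mulrC ler_wpM2l// invr_ge0 ltW//.
have h01 (a : R) n (t : R) : (0 < n)%N -> 0 <= hat a h n t <= 1.
  by move=> n0; rewrite hatE// tent_ge0 tent_le1.
have -> : 2 / h * eucl_norm s = h^-1 * eucl_norm s + h^-1 * eucl_norm s by ring.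
apply: (le_trans (ler_normD _ _)); apply: lerD.
  apply: (lip _ _ _ s.1); [|exact: h01|exact: ler_fst_eucl_norm].
  by rewrite (le_trans (hat_lipschitz _ _ _ _ _))// addrC addKr.
rewrite mulrC; apply: (lip _ _ _ s.2); [|exact: h01|exact: ler_snd_eucl_norm].
by rewrite (le_trans (hat_lipschitz _ _ _ _ _))// addrC addKr.
Qed.

Lemma basis_support n1 n2 x : (0 < n1 <= N1)%N -> (0 < n2 <= N2)%N ->
  basis a1 a2 h n1 n2 x != 0 -> a1 < x.1 < b1 /\ a2 < x.2 < b2.
Proof.
move=> n1N n2N; rewrite mulf_eq0 negb_or => /andP[u1 u2]; split.
  exact: (hat_support h0 n1N b1E u1).
exact: (hat_support h0 n2N b2E u2).
Qed.

Lemma measurable_basis n1 n2 : (0 < n1)%N -> (0 < n2)%N ->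
  measurable_fun setT (basis a1 a2 h n1 n2 : R * R -> R).
Proof.
move=> n10 n20.
by apply: measurable_funM; apply: measurableT_comp => //; exact: measurable_hat.
Qed.

Lemma integral_basis_basis n1 n2 m1 m2 (al be : R * R) :
  (0 < n1)%N -> (0 < n2)%N -> (0 < m1)%N -> (0 < m2)%N ->
  (\int[lebesgue2 R]_x
     (basis a1 a2 h n1 n2 (x + al) * basis a1 a2 h m1 m2 (x + be))%:E =
   (h ^+ 2 * (B3 (2 + (n1%:R - m1%:R + (be.1 - al.1) / h))
            * B3 (2 + (n2%:R - m2%:R + (be.2 - al.2) / h))))%:E)%E.
Proof.
move=> n10 n20 m10 m20.
have mhat a k (c : R) : (0 < k)%N -> measurable_fun setT (fun x : R => hat a h k (x + c)).
  move=> k0; apply: measurableT_comp; first exact: measurable_hat.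
  exact: measurable_funD.
pose P (t : R) := hat a1 h n1 (t + al.1) * hat a1 h m1 (t + be.1).
pose Q (t : R) := hat a2 h n2 (t + al.2) * hat a2 h m2 (t + be.2).
have mP : measurable_fun setT P by apply: measurable_funM; exact: mhat.
have mQ : measurable_fun setT Q by apply: measurable_funM; exact: mhat.
have P0 t : 0 <= P t by rewrite mulr_ge0// hat_ge0.
have Q0 t : 0 <= Q t by rewrite mulr_ge0// hat_ge0.
transitivity (\int[lebesgue2 R]_x (P x.1 * Q x.2)%:E)%E.
  by apply: eq_integral => x _; congr EFin; rewrite /basis /P /Q /=; ring.
rewrite tonelli12; last 2 first.
- by apply/measurable_EFinP; apply: measurable_funM; exact: measurableT_comp.
- by move=> z; rewrite lee_fin mulr_ge0.
have QE := integral_hat_hat a2 al.2 be.2 h0 n20 m20.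
have PE := integral_hat_hat a1 al.1 be.1 h0 n10 m10.
have inner t : (\int[mu]_y (P t * Q y)%:E = (P t)%:E * \int[mu]_y (Q y)%:E)%E.
  under eq_integral do rewrite EFinM.
  rewrite ge0_integralZl//; first exact/measurable_EFinP.
  - by move=> y _; rewrite lee_fin.
  - by rewrite lee_fin.
under eq_integral do rewrite /= inner [X in (_ * X)%E]QE.
rewrite ge0_integralZr//; last 3 first.
- exact/measurable_EFinP.
- by move=> x _; rewrite lee_fin.
- rewrite -QE; apply: integral_ge0 => y _; rewrite lee_fin; exact: Q0.
rewrite PE -EFinM; congr EFin; ring.
Qed.

End basis.

(** * Integrability on a product *)

(** The dominating function is a tensor product, whose integral is the product
    of two finite numbers. *)
Lemma integrable_prod_dominated d1 d2 (T1 : measurableType d1)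
    (T2 : measurableType d2) (R : realType)
    (m1 : {sigma_finite_measure set T1 -> \bar R})
    (m2 : {sigma_finite_measure set T2 -> \bar R})
    (E : set T1) (g : T2 -> R) (f : T1 * T2 -> R) :
  measurable E -> (m1 E < +oo)%E -> m2.-integrable setT (EFin \o g) ->
  measurable_fun setT f ->
  (forall x y, `|f (x, y)| <= \1_E x * `|g y|) ->
  (m1 \x m2)%E.-integrable setT (EFin \o f).
Proof.
move=> mE Efin intg mf fg.
have mef : measurable_fun setT (EFin \o f) by exact/measurable_EFinP.
have mg : measurable_fun setT g by exact/measurable_EFinP/(measurable_int _ intg).
apply/integrable12ltyP => //.
have [_ gfin] := integrableP _ _ _ intg.
apply: (@le_lt_trans _ _ (\int[m1]_x ((\1_E x)%:E * \int[m2]_y `|(g y)%:E|))%E).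
  apply: ge0_le_integral => //.
  - by move=> x _; exact: integral_ge0.
  - apply: (measurable_fun_fubini_tonelli_F (fun z => `|(f z)%:E|%E)) => //.
    exact: measurableT_comp.
  - apply: emeasurable_funM => //.
    by apply/measurable_EFinP; exact: measurable_indic.
  - move=> x _; rewrite -ge0_integralZl//; last first.
      by apply: measurableT_comp => //; exact/measurable_EFinP.
    apply: ge0_le_integral => //.
    + apply: measurableT_comp => //; apply/measurable_EFinP.
      exact: (measurableT_comp mf (pair1_measurable x)).
    + apply: emeasurable_funM => //.
      by apply: measurableT_comp => //; exact/measurable_EFinP.
    + by move=> y _; rewrite /= -EFinM lee_fin; exact: fg.
rewrite ge0_integralZr//; last 2 first.
- by apply/measurable_EFinP; exact: measurable_indic.
- exact: integral_ge0.
rewrite integral_indic// setIT.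
by apply: lte_mul_pinfty => //; rewrite ge0_fin_numE.
Qed.

Section plane_measure.
Context {R : realType}.
Notation mu := (@lebesgue_measure R).

Lemma finite_square (a b c d : R) : (lebesgue2 R (`]a, b[ `*` `]c, d[) < +oo)%E.
Proof.
have fin_itv (x y : R) : (mu `]x, y[ < +oo)%E.
  by rewrite lebesgue_measure_itv/=; case: ifP => _; rewrite ?ltry// -EFinD ltry.
rewrite -[X in (X < _)%E]/((mu \x mu)%E (`]a, b[ `*` `]c, d[)).
rewrite product_measure1E; [|exact: measurable_itv..].
apply: lte_mul_pinfty => //; last exact: fin_itv.
by rewrite ge0_fin_numE//; exact: fin_itv.
Qed.

Lemma sigma_finite_lebesgue2 : sigma_finite setT (lebesgue2 R).
Proof.
exists (fun n => `]- n%:R, n%:R[ `*` `]- n%:R, n%:R[).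
  apply/seteqP; split => // -[x y] _.
  exists (Num.bound (`|x| + `|y|)) => //=.
  have := archi_boundP (addr_ge0 (normr_ge0 x) (normr_ge0 y)).
  rewrite !in_itv/= -!ltr_norml => xyn.
  by split; apply: le_lt_trans xyn; rewrite ?lerDl ?lerDr.
by move=> n; split; [apply: measurableX; exact: measurable_itv|exact: finite_square].
Qed.

(** A copy of lebesgue2 that carries the sigma-finite structure required by
    Fubini's theorem on pairs of points of the plane. *)
Definition plane_measure :
  set (measurableTypeR R * measurableTypeR R)%type -> \bar R := (mu \x mu)%E.

HB.instance Definition _ := Measure.on plane_measure.
HB.instance Definition _ :=
  Measure_isSigmaFinite.Build _ _ _ plane_measure sigma_finite_lebesgue2.

End plane_measure.
Arguments plane_measure R : clear implicits.

(** * The bilinear form on basis functions *)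

Section stiffness.
Context {R : realType}.
Local Notation basis := Defs.basis.
Implicit Types x y s : R * R.

(** For natural numbers k1 and k2 this is fhat with s in Cartesian coordinates;
    node differences may be negative. *)
Definition spline_difference (h k1 k2 : R) s : R :=
  2 * B3 (k1 + 2) * B3 (k2 + 2)
  - B3 (k1 + 2 + s.1 / h) * B3 (k2 + 2 + s.2 / h)
  - B3 (k1 + 2 - s.1 / h) * B3 (k2 + 2 - s.2 / h).

Variables (a1 a2 h : R).
Hypotheses (h0 : 0 < h).
Variables (n1 n2 m1 m2 : nat).
Hypotheses (n10 : (0 < n1)%N) (n20 : (0 < n2)%N).
Hypotheses (m10 : (0 < m1)%N) (m20 : (0 < m2)%N).

Let u := basis a1 a2 h n1 n2.
Let v := basis a1 a2 h m1 m2.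

Definition increment_product x s := (u (x + s) - u x) * (v (x + s) - v x).

Lemma measurable_shifted_basis (w : R * R -> R) s : measurable_fun setT w ->
  measurable_fun setT (fun x => w (x + s)).
Proof.
move=> mw; apply: measurableT_comp => //.
by apply: measurable_fun_pair; exact: measurable_funD.
Qed.

Let c al be x := u (x + al) * v (x + be).

Let integrable_c al be : (lebesgue2 R).-integrable setT (EFin \o c al be).
Proof.
have mu_u : measurable_fun setT u by exact: measurable_basis.
have mv : measurable_fun setT v by exact: measurable_basis.
apply/integrableP; split.
  apply/measurable_EFinP.
  by apply: measurable_funM; exact: measurable_shifted_basis.
have -> : (\int[lebesgue2 R]_x `|(EFin \o c al be) x| =
    \int[lebesgue2 R]_x (c al be x)%:E)%E.
  apply: eq_integral => x _; rewrite /= ger0_norm//.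
  by rewrite !mulr_ge0// hat_ge0.
by rewrite integral_basis_basis// ltry.
Qed.

Let integrable_cB al be al' be' : (lebesgue2 R).-integrable setT
  (EFin \o (fun x => c al be x - c al' be' x)).
Proof.
have := integrableB measurableT (integrable_c al be) (integrable_c al' be').
by apply: eq_integrable => // x _ /=; rewrite EFinB.
Qed.

Let increment_productE x s :
  increment_product x s = c s s x - c s 0 x - (c 0 s x - c 0 0 x).
Proof. by rewrite /c !addr0 /increment_product; ring. Qed.

Lemma integrable_increment_product s :
  (lebesgue2 R).-integrable setT (EFin \o increment_product ^~ s).
Proof.
have := integrableB measurableT (integrable_cB s s s 0) (integrable_cB 0 s 0 0).
by apply: eq_integrable => // x _ /=; rewrite increment_productE EFinB.
Qed.

(** Each of the four terms of the expanded product is a product of two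
    one-dimensional correlations of hats. *)
Lemma Rintegral_increment_product s :
  \int[lebesgue2 R]_x increment_product x s =
  h ^+ 2 * spline_difference h (n1%:R - m1%:R) (n2%:R - m2%:R) s.
Proof.
have cE al be := integral_basis_basis a1 a2 h0 al be n10 n20 m10 m20.
have rc al be : \int[lebesgue2 R]_x c al be x = fine (\int[lebesgue2 R]_x (c al be x)%:E)%E by [].
transitivity (\int[lebesgue2 R]_x (c s s x - c s 0 x - (c 0 s x - c 0 0 x))).
  by apply: eq_Rintegral => x _; exact: increment_productE.
have -> : \int[lebesgue2 R]_x (c s s x - c s 0 x - (c 0 s x - c 0 0 x)) =
    \int[lebesgue2 R]_x (c s s x - c s 0 x) - \int[lebesgue2 R]_x (c 0 s x - c 0 0 x).
  by apply: RintegralB => //; exact: integrable_cB.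
have Bc al be al' be' : \int[lebesgue2 R]_x (c al be x - c al' be' x) =
    \int[lebesgue2 R]_x c al be x - \int[lebesgue2 R]_x c al' be' x.
  by apply: RintegralB => //; exact: integrable_c.
rewrite !Bc.
rewrite !rc !cE /= /spline_difference !subrr !mul0r !addr0 !sub0r !subr0 !mulNr.
set k1 := n1%:R - m1%:R; set k2 := n2%:R - m2%:R.
rewrite ![2 + _]addrC.
have swap (k t : R) : k + t + 2 = k + 2 + t by ring.
rewrite !swap.
ring.
Qed.

End stiffness.

Section bilinear_form.
Context {R : realType}.
Local Notation basis := Defs.basis.
Implicit Types x y s : R * R.

Variables (a1 b1 a2 b2 delta h : R) (N1 N2 : nat) (rho : R -> R).
Hypotheses (h0 : 0 < h).
Hypotheses (b1E : b1 = a1 + (N1 + 1)%:R * h) (b2E : b2 = a2 + (N2 + 1)%:R * h).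
Hypothesis delta0 : 0 < delta.
Hypothesis rho_mono : forall r s : R, 0 < r -> r <= s -> s < delta -> rho s <= rho r.
Hypothesis rho_norm : (\int[lebesgue2 R]_(s in disc delta)
  (rho (eucl_norm s) * eucl_norm s ^+ 2)%:E = 2%:E)%E.

Variables (n1 n2 m1 m2 : nat).
Hypotheses (n1N : (0 < n1 <= N1)%N) (n2N : (0 < n2 <= N2)%N).
Hypotheses (m1N : (0 < m1 <= N1)%N) (m2N : (0 < m2 <= N2)%N).

Let n10 : (0 < n1)%N. Proof. by case/andP: n1N. Qed.
Let n20 : (0 < n2)%N. Proof. by case/andP: n2N. Qed.
Let m10 : (0 < m1)%N. Proof. by case/andP: m1N. Qed.
Let m20 : (0 < m2)%N. Proof. by case/andP: m2N. Qed.

Let w : R -> R := cut_kernel delta rho.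
Let D := increment_product a1 a2 h n1 n2 m1 m2.
Let OmegaExt := extended_domain a1 b1 a2 b2 delta.

(** A shift by less than delta cannot bring a point from outside the extended
    domain into Omega, where the basis functions live. *)
Let increment_eq0 k1 k2 x s : (0 < k1 <= N1)%N -> (0 < k2 <= N2)%N ->
  x \notin OmegaExt -> eucl_norm s < delta ->
  basis a1 a2 h k1 k2 (x + s) - basis a1 a2 h k1 k2 x = 0.
Proof.
move=> k1N k2N; rewrite notin_setE => xO sd.
have /andP[s1l s1r] : - delta < s.1 < delta.
  by rewrite -ltr_norml (le_lt_trans (ler_fst_eucl_norm s)).
have /andP[s2l s2r] : - delta < s.2 < delta.
  by rewrite -ltr_norml (le_lt_trans (ler_snd_eucl_norm s)).
have inO (y : R * R) : a1 < y.1 < b1 /\ a2 < y.2 < b2 ->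
    `|x.1 - y.1| < delta -> `|x.2 - y.2| < delta -> OmegaExt x.
  move=> [/andP[? ?] /andP[? ?]]; rewrite !ltr_norml => /andP[? ?] /andP[? ?].
  by split => /=; rewrite in_itv/=; apply/andP; split; lra.
have -> : basis a1 a2 h k1 k2 (x + s) = 0.
  apply: contrapT => /eqP ux; apply: xO.
  apply: (inO _ (basis_support h0 b1E b2E k1N k2N ux)) => /=.
    by rewrite opprD addNKr normrN ltr_norml s1l.
  by rewrite opprD addNKr normrN ltr_norml s2l.
have -> : basis a1 a2 h k1 k2 x = 0.
  apply: contrapT => /eqP ux; apply: xO.
  by apply: (inO _ (basis_support h0 b1E b2E k1N k2N ux)); rewrite subrr normr0.
by rewrite subrr.
Qed.

Let wE s : delta <= eucl_norm s -> w (eucl_norm s) = 0.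
Proof.
move=> sd; rewrite /w /cut_kernel patchE ifF//; apply/negbTE.
by rewrite notin_setE/= in_itv/= => /andP[_]; rewrite ltNge sd.
Qed.

Let D_outside x s : x \notin OmegaExt -> D x s * w (eucl_norm s) = 0.
Proof.
move=> xO; have [sd|sd] := ltP (eucl_norm s) delta; last by rewrite wE// mulr0.
by rewrite /D /increment_product increment_eq0// !mul0r.
Qed.

(** The Lipschitz bound on both increments supplies the factor |s|^2 that
    compensates the singularity of the kernel. *)
Let D_bound x s :
  `|D x s * w (eucl_norm s)| <=
  \1_OmegaExt x * `|(2 / h) ^+ 2 * (eucl_norm s ^+ 2 * w (eucl_norm s))|.
Proof.
rewrite indicE; have [xO|xO] := boolP (x \in OmegaExt); last first.
  by rewrite D_outside// normr0 mul0r.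
have h20 : 0 <= 2 / h by rewrite divr_ge0// ltW.
have s0 := eucl_norm_ge0 s.
rewrite mul1r mulrA normrM [leRHS]normrM ler_wpM2r// -exprMn.
rewrite [leRHS]ger0_norm ?sqr_ge0// expr2 [D x s]/(_ * _) normrM.
by apply: ler_pM => //; exact: basis_lipschitz.
Qed.

Let measurable_D : measurable_fun setT
  (fun z : (R * R) * (R * R) => D z.1 z.2 * w (eucl_norm z.2)).
Proof.
have madd : measurable_fun setT (fun z : (R * R) * (R * R) => z.1 + z.2).
  apply: measurable_fun_pair; apply: measurable_funD.
  - exact: (measurableT_comp measurable_fst measurable_fst).
  - exact: (measurableT_comp measurable_fst measurable_snd).
  - exact: (measurableT_comp measurable_snd measurable_fst).
  - exact: (measurableT_comp measurable_snd measurable_snd).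
have mincr k1 k2 : (0 < k1)%N -> (0 < k2)%N -> measurable_fun setT
    (fun z : (R * R) * (R * R) =>
       basis a1 a2 h k1 k2 (z.1 + z.2) - basis a1 a2 h k1 k2 z.1).
  move=> k10 k20; have mb := measurable_basis a1 a2 h0 k10 k20.
  by apply: measurable_funB; [exact: (measurableT_comp mb madd)|
                              exact: (measurableT_comp mb measurable_fst)].
apply: measurable_funM; first by apply: measurable_funM; exact: mincr.
apply: measurableT_comp; first exact: measurable_cut_kernel.
exact: (measurableT_comp measurable_eucl_norm measurable_snd).
Qed.

Let integrable_D :
  (plane_measure R \x plane_measure R)%E.-integrable setT
    (EFin \o (fun z : (R * R) * (R * R) => D z.1 z.2 * w (eucl_norm z.2))).
Proof.
have mO : measurable OmegaExt by apply: measurableX; exact: measurable_itv.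
pose g s := (2 / h) ^+ 2 * (eucl_norm s ^+ 2 * w (eucl_norm s)).
have intg : (plane_measure R).-integrable setT (EFin \o g).
  have := integrableZl measurableT ((2 / h) ^+ 2) (integrable_kernel rho_mono rho_norm).
  by apply: eq_integrable => // s _; rewrite /= EFinM.
have finO : (plane_measure R OmegaExt < +oo)%E by exact: finite_square.
have dominated := @integrable_prod_dominated _ _ _ _ _
  (plane_measure R) (plane_measure R) OmegaExt g
  (fun z => D z.1 z.2 * w (eucl_norm z.2)) mO finO intg measurable_D.
by apply: dominated; exact: D_bound.
Qed.

Let k1 : R := n1%:R - m1%:R.
Let k2 : R := n2%:R - m2%:R.

Let integrable_D1 s : (lebesgue2 R).-integrable setT
  (EFin \o (fun x => D x s * w (eucl_norm s))).
Proof.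
have := integrableZr measurableT (w (eucl_norm s))
  (integrable_increment_product a1 a2 h0 n10 n20 m10 m20 s).
by apply: eq_integrable => // x _ /=; rewrite EFinM.
Qed.

Let Rintegral_D s :
  \int[lebesgue2 R]_x (D x s * w (eucl_norm s)) =
  h ^+ 2 * (w (eucl_norm s) * spline_difference h k1 k2 s).
Proof.
rewrite RintegralZr//; last exact: integrable_increment_product.
rewrite Rintegral_increment_product// -/k1 -/k2; ring.
Qed.

(** Integrability in s is inherited from the joint integrability in (x, s) by
    integrating out x. *)
Lemma integrable_kernel_spline : (lebesgue2 R).-integrable setT
  (fun s => (w (eucl_norm s) * spline_difference h k1 k2 s)%:E).
Proof.
have int2 : (lebesgue2 R).-integrable setT
    (fun s => \int[lebesgue2 R]_x (D x s * w (eucl_norm s))%:E)%E.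
  exact: (integrable_fubini2 integrable_D).
have := integrableZl measurableT (h ^+ 2)^-1 int2.
apply: eq_integrable => // s _.
have -> : (\int[lebesgue2 R]_x (D x s * w (eucl_norm s))%:E =
    (h ^+ 2 * (w (eucl_norm s) * spline_difference h k1 k2 s))%:E)%E.
  rewrite -Rintegral_D /Rintegral fineK//.
  exact: (integrable_fin_num measurableT (integrable_D1 s)).
by rewrite -EFinM mulKf// expf_neq0// gt_eqF.
Qed.

Lemma bilinear_formE :
  bilinear_form a1 b1 a2 b2 delta rho (basis a1 a2 h n1 n2) (basis a1 a2 h m1 m2) =
  h ^+ 2 / 2 *
  \int[lebesgue2 R]_s (w (eucl_norm s) * spline_difference h k1 k2 s).
Proof.
rewrite /bilinear_form.
have inner x : \int[lebesgue2 R]_(s in disc delta) (D x s * rho (eucl_norm s)) =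
    \int[lebesgue2 R]_s (D x s * w (eucl_norm s)).
  rewrite /Rintegral integral_disc_kernel//.
  by rewrite /D /increment_product !addr0 subrr mul0r.
have -> : \int[lebesgue2 R]_(x in OmegaExt) \int[lebesgue2 R]_(s in disc delta)
      (D x s * rho (eucl_norm s)) =
    \int[lebesgue2 R]_x \int[lebesgue2 R]_s (D x s * w (eucl_norm s)).
  rewrite Rintegral_mkcond; apply: eq_Rintegral => x _.
  rewrite patchE inner; case: ifPn => // xO.
  by rewrite /Rintegral integral0_eq// => s _; rewrite D_outside.
(* Exchanging the integrals makes the x-integral, which is explicit, the inner one. *)
have swap : \int[lebesgue2 R]_x \int[lebesgue2 R]_s (D x s * w (eucl_norm s)) =
    \int[lebesgue2 R]_s \int[lebesgue2 R]_x (D x s * w (eucl_norm s)).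
  exact: etrans (Rintegral_fubini1 integrable_D) (esym (Rintegral_fubini2 integrable_D)).
rewrite swap.
under eq_Rintegral => s _ do rewrite Rintegral_D.
rewrite (RintegralZl _ measurableT integrable_kernel_spline).
by rewrite mulrA [2^-1 * _]mulrC.
Qed.

End bilinear_form.

Section entry.
Context {R : realType}.
Local Notation basis := Defs.basis.

Let B3N (k t : R) : B3 (- k + 2 + t) = B3 (k + 2 - t).
Proof.
have -> : - k + 2 + t = 2 - (k - t) by ring.
by rewrite B3_sym; congr B3; ring.
Qed.

(** The symmetry of B3 trades the sign of a node difference for a reflection
    of s. *)
Lemma spline_differenceN1 (h k1 k2 : R) (s : R * R) :
  spline_difference h (- k1) k2 s = spline_difference h k1 k2 (- s.1, s.2).
Proof.
have B0 : B3 (- k1 + 2) = B3 (k1 + 2) by rewrite -[in LHS](addr0 (_ + 2)) B3N subr0.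
by rewrite /spline_difference/= B0 !B3N mulNr opprK.
Qed.

Lemma spline_differenceNN (h k1 k2 : R) (s : R * R) :
  spline_difference h (- k1) (- k2) s = spline_difference h k1 k2 s.
Proof.
have B0 (k : R) : B3 (- k + 2) = B3 (k + 2) by rewrite -[in LHS](addr0 (_ + 2)) B3N subr0.
by rewrite /spline_difference !B0 !B3N !opprK; ring.
Qed.

Lemma spline_difference_even (h k1 k2 x y : R) :
  spline_difference h k1 k2 (- x, - y) = spline_difference h k1 k2 (x, y).
Proof. by rewrite /spline_difference/= !mulNr !opprK; ring. Qed.

Lemma eucl_norm_polar (r t : R) : 0 < r -> eucl_norm (r * cos t, r * sin t) = r.
Proof.
move=> r0; rewrite /eucl_norm/= !exprMn -mulrDr cos2Dsin2 mulr1.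
by rewrite sqrtr_sqr gtr0_norm.
Qed.

Lemma natr_distn (n m : nat) :
  (n%:R - m%:R = `|n - m|%N%:R :> R) \/ (n%:R - m%:R = - `|n - m|%N%:R :> R).
Proof.
by case: (leqP m n) => [mn|/ltnW nm]; [left|right];
  rewrite ?(distnEl mn) ?(distnEr nm) natrB// opprB.
Qed.

(** On the ray of angle theta the spline difference is fhat and |s| is r, so the
    extension by zero of the kernel restricts r to ]0, delta[. *)
Lemma Rintegral_kernel_spline (delta h : R) (rho : R -> R) (k1 k2 : nat) :
  (lebesgue2 R).-integrable setT (fun s =>
    (cut_kernel delta rho (eucl_norm s) * spline_difference h k1%:R k2%:R s)%:E) ->
  h ^+ 2 / 2 * \int[lebesgue2 R]_s
    (cut_kernel delta rho (eucl_norm s) * spline_difference h k1%:R k2%:R s) =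
  toeplitz_coef delta h rho k1 k2.
Proof.
move=> intf; have two0 : (2 : R) != 0 by rewrite pnatr_eq0.
rewrite (Rintegral_polar intf); last first.
  by move=> x y; rewrite spline_difference_even /eucl_norm/= !sqrrN.
rewrite /toeplitz_coef mulrA (mulfVK two0) {intf}; congr (_ * _).
apply: eq_Rintegral => t _.
rewrite Rintegral_mkcond [RHS]Rintegral_mkcond; apply: eq_Rintegral => r _.
rewrite !patchE /=.
have -> : (r \in `]0, +oo[%classic) = (0 < r) by apply/idP/idP; rewrite inE/= in_itv/= andbT.
case: ifPn => [r0|r0]; last first.
  by rewrite ifF//; apply/negbTE; rewrite notin_setE/= in_itv/= (negbTE r0).
rewrite eucl_norm_polar// /cut_kernel patchE.
by case: ifPn => // _; rewrite ?mul0r ?mulr0// mulrA.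
Qed.

(** If the two node differences have the same sign, the spline difference does
    not see it; if they have opposite signs, reflecting s, which preserves |s|,
    restores the case of equal signs. *)
Lemma bilinear_form_toeplitz (a1 b1 a2 b2 delta h : R) (N1 N2 : nat) (rho : R -> R) 
   (n1 n2 m1 m2 : nat) :
  0 < h -> b1 = a1 + (N1 + 1)%:R * h -> b2 = a2 + (N2 + 1)%:R * h -> 0 < delta ->
  (forall r s : R, 0 < r -> r <= s -> s < delta -> rho s <= rho r) ->
  (\int[lebesgue2 R]_(s in disc delta)
     (rho (eucl_norm s) * eucl_norm s ^+ 2)%:E = 2%:E)%E ->
  (0 < n1 <= N1)%N -> (0 < n2 <= N2)%N -> (0 < m1 <= N1)%N -> (0 < m2 <= N2)%N ->
  bilinear_form a1 b1 a2 b2 delta rho (basis a1 a2 h n1 n2) (basis a1 a2 h m1 m2) =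
  toeplitz_coef delta h rho `|n1 - m1|%N `|n2 - m2|%N.
Proof.
move=> h0 b1E b2E d0 rho_mono rho_norm n1N n2N m1N m2N.
have intk := integrable_kernel_spline h0 b1E b2E d0 rho_mono rho_norm n1N n2N m1N m2N.
rewrite (bilinear_formE h0 b1E b2E d0 rho_mono rho_norm n1N n2N m1N m2N).
move: intk; set k1 := n1%:R - m1%:R; set k2 := n2%:R - m2%:R => intk.
pose f (k k' : R) (s : R * R) := cut_kernel delta rho (eucl_norm s) * spline_difference h k k' s.
have fN1 k k' s : f (- k) k' (- s.1, s.2) = f k k' s.
  by rewrite /f spline_differenceN1 /= opprK /eucl_norm/= sqrrN; case: s.
have fNN k k' : f (- k) (- k') = f k k'.
  by apply/funext => s; rewrite /f spline_differenceNN.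
have reflect k k' : (lebesgue2 R).-integrable setT (EFin \o f (- k) k') ->
    (lebesgue2 R).-integrable setT (EFin \o f k k') /\
    \int[lebesgue2 R]_s f (- k) k' s = \int[lebesgue2 R]_s f k k' s.
  move=> intf; split.
    by apply: eq_integrable (integrable_reflect intf) => // s _; rewrite /= fN1.
  by rewrite -(Rintegral_reflect intf); apply: eq_Rintegral => s _; rewrite fN1.
have [intK eqK] : (lebesgue2 R).-integrable setT (EFin \o f `|n1 - m1|%N%:R `|n2 - m2|%N%:R) /\
    \int[lebesgue2 R]_s f k1 k2 s = \int[lebesgue2 R]_s f `|n1 - m1|%N%:R `|n2 - m2|%N%:R s.
  have {}intk : (lebesgue2 R).-integrable setT (EFin \o f k1 k2) by exact: intk.
  move: intk; rewrite /k1 /k2.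
  have [-> | ->] := natr_distn n1 m1; have [-> | ->] := natr_distn n2 m2.
  - by [].
  - by rewrite -(fNN _ (- _)) opprK; exact: reflect.
  - exact: reflect.
  - by rewrite fNN.
rewrite -[X in _ * X]/(\int[lebesgue2 R]_s f k1 k2 s) eqK.
exact: Rintegral_kernel_spline.
Qed.

End entry.

(** * Block Toeplitz structure *)

(** All blocks have size N1, so the position in the list of blocks is a
    Euclidean division. *)
Lemma tagnat_sig_divn (N1 N2 : nat) (s : 'I_(\sum_(p < N2) N1)) :
  (tagnat.sig1 s = s %/ N1 :> nat)%N /\ (tagnat.sig2 s = s %% N1 :> nat)%N.
Proof.
have sE := tagnat.rect s.
have sumE : (\sum_(i < N2 | (i < tagnat.sig1 s)%N) N1 = tagnat.sig1 s * N1)%N.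
  rewrite -(big_ord_widen N2 (fun=> N1)) ?(ltnW (ltn_ord _))//.
  by rewrite sum_nat_const card_ord.
rewrite sumE in sE.
have lt2 := ltn_ord (tagnat.sig2 s); have N1_gt0 := leq_ltn_trans (leq0n _) lt2.
split; rewrite [X in (X %/ _)%N]sE || rewrite [X in (X %% _)%N]sE.
  by rewrite divnMDl// divn_small// addn0.
by rewrite modnMDl modn_small.
Qed.

Lemma sym_block_toeplitzE (R : Type) (N1 N2 : nat) (t : nat -> nat -> R)
    (l l' : 'I_(N1 * N2)) :
  sym_block_toeplitz N2 (fun k2 => sym_toeplitz N1 (t k2)) l l' =
  t `|l %/ N1 - l' %/ N1|%N `|l %% N1 - l' %% N1|%N.
Proof.
rewrite castmxE !mxE.
have [d1 m1] := tagnat_sig_divn (cast_ord (esym (block_size N1 N2)) l).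
have [d2 m2] := tagnat_sig_divn (cast_ord (esym (block_size N1 N2)) l').
by rewrite d1 d2 m1 m2.
Qed.

Theorem corollary1 (R : realType) (a1 b1 a2 b2 delta h : R) (N1 N2 : nat)
  (rho : R -> R)
  (hab1 : a1 < b1) (hab2 : a2 < b2)
  (hN1 : (1 <= N1)%N) (hN2 : (1 <= N2)%N)
  (hh1 : h = (b1 - a1) / (N1 + 1)%:R) (hh2 : h = (b2 - a2) / (N2 + 1)%:R)
  (hdelta : 0 < delta)
  (hrho_mono : forall r s : R, 0 < r -> r <= s -> s < delta -> rho s <= rho r)
  (hrho_norm : (\int[lebesgue2 R]_(s in disc delta)
                  (rho (eucl_norm s) * eucl_norm s ^+ 2)%:E = 2%:E)%E) :
  stiffness_matrix a1 b1 a2 b2 delta h rho N1 N2 =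
  sym_block_toeplitz N2 (fun k2 => sym_toeplitz N1 (fun k1 =>
    toeplitz_coef delta h rho k1 k2)).
Proof.
have N_gt0 (N : nat) : (0 : R) < (N + 1)%:R by rewrite ltr0n addn1.
have h0 : 0 < h by rewrite hh1 divr_gt0// subr_gt0.
have b1E : b1 = a1 + (N1 + 1)%:R * h by rewrite hh1 mulrC divfK ?gt_eqF// addrC subrK.
have b2E : b2 = a2 + (N2 + 1)%:R * h by rewrite hh2 mulrC divfK ?gt_eqF// addrC subrK.
have mod_lt (l : 'I_(N1 * N2)) : (0 < (l %% N1).+1 <= N1)%N by rewrite ltn_pmod.
have div_lt (l : 'I_(N1 * N2)) : (0 < (l %/ N1).+1 <= N2)%N.
  by rewrite /= ltn_divLR// (leq_trans (ltn_ord l))// mulnC.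
apply/matrixP => l l'.
rewrite (sym_block_toeplitzE (fun k2 k1 => toeplitz_coef delta h rho k1 k2)) mxE.
rewrite (bilinear_form_toeplitz h0 b1E b2E hdelta hrho_mono hrho_norm
  (mod_lt l) (div_lt l) (mod_lt l') (div_lt l')).
have distSS (a b : nat) : `|a.+1 - b.+1|%N = `|a - b|%N.
  by rewrite -(addn1 a) -(addn1 b) distnDr.
by rewrite !distSS.
Qed.
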